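(* Let $\mathcal{C}$ be a class of Banach spaces, let $\mathcal{A}$ be a $\mathcal{C}$-admissible assignment (as defined in the context) which moreover satisfies: for every Banach space $E$, if $A_1,A_2\in\mathcal{A}(E)$, then there is $A\in\mathcal{A}(E)$ such that $A_1\cup A_2\subseteq A$. Let $\tau_{\mathcal{A}}$ be the corresponding $\mathcal{C}$-projective ideal topology, and let $\mathcal{I},\mathcal{J}$ be operator ideals such that $\mathcal{L}[\mathcal{I}]\subseteq\overline{\mathcal{I}}^{\,\tau_{\mathcal{A}}}\circ\mathcal{L}$. Let $E\in\mathcal{C}$. (1) If $\mathcal{J}\circ\mathcal{L}(^nE;\widehat\otimes^n_\pi E)\subseteq\otimes^n\mathcal{J}(^nE;\widehat\otimes^n_\pi E)$ for every $n\in\mathbb{N}$, then the following are equivalent: (a) $E$ has the $(\mathcal{J},\mathcal{I},\tau_{\mathcal{A}})$-WAP. (b) $\widehat\otimes^n_\pi E$ has the $(\mathcal{J},\mathcal{I},\tau_{\mathcal{A}})$-WAP for every $n$. (c) $\widehat\otimes^n_\pi E$ has the $(\mathcal{J},\mathcal{I},\tau_{\mathcal{A}})$-WAP for some $n$. (d) $\widehat\otimes^n_{s,\pi}E$ has the $(\mathcal{J},\mathcal{I},\tau_{\mathcal{A}})$-WAP for every $n$. (e) $\widehat\otimes^n_{s,\pi}E$ has the $(\mathcal{J},\mathcal{I},\tau_{\mathcal{A}})$-WAP for some $n$. (2) If $n\in\mathbb{N}$ is such that $\mathcal{J}\circ\mathcal{L}(^nE;\widehat\otimes^n_\pi E)\subseteq\otimes^n\mathcal{J}(^nE;\widehat\otimes^n_\pi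 E)$, then the following are equivalent: (a) $E$ has the $(\mathcal{J},\mathcal{I},\tau_{\mathcal{A}})$-WAP. (b) $\widehat\otimes^k_\pi E$ has the $(\mathcal{J},\mathcal{I},\tau_{\mathcal{A}})$-WAP for every $k\le n$. (c) $\widehat\otimes^k_\pi E$ has the $(\mathcal{J},\mathcal{I},\tau_{\mathcal{A}})$-WAP for some $k\le n$. (d) $\widehat\otimes^k_{s,\pi}E$ has the $(\mathcal{J},\mathcal{I},\tau_{\mathcal{A}})$-WAP for every $k\le n$. (e) $\widehat\otimes^k_{s,\pi}E$ has the $(\mathcal{J},\mathcal{I},\tau_{\mathcal{A}})$-WAP for some $k\le n$.
   Context: All Banach spaces are over $\mathbb{K}=\mathbb{R}$ or $\mathbb{C}$; $n,k$ range over positive integers. $\mathcal{L}(E;F)$, $\mathcal{L}(E_1,\dots,E_n;F)$ and $\mathcal{P}(^nE;F)$ are the spaces of bounded linear operators, continuous $n$-linear mappings and continuous $n$-homogeneous polynomials; $\mathcal{L}(^nE;F)=\mathcal{L}(E,\dots,E;F)$. $E_1\widehat\otimes_\pi\cdots\widehat\otimes_\pi E_n$ is the completed projective tensor product, $\widehat\otimes^n_\pi E$ the case $E_1=\cdots=E_n=E$, and $\widehat\otimes^n_{s,\pi}E$ the completed $n$-fold symmetric projective tensor product. For sets, $A_1\otimes\cdots\otimes A_n:=\{x_1\otimes\cdots\otimes x_n: x_j\in A_j\}$, $\otimes^n_sA:=\{x\otimes\cdots\otimes x: x\in A\}$; $\overline{\mathrm{co}}$ is the closed convex hull. Operator ideals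 are in the sense of Pietsch: each component $\mathcal{I}(E;F)$ is a linear subspace of $\mathcal{L}(E;F)$ containing the finite rank operators, and $w\circ v\circ u\in\mathcal{I}$ whenever $v\in\mathcal{I}$ and $u,w$ are bounded operators. A $\mathcal{C}$-admissible assignment $\mathcal{A}$ assigns to every Banach space $E$ a collection $\mathcal{A}(E)$ of bounded subsets of $E$ containing the singletons, such that $u(A)\in\mathcal{A}(F)$ for all Banach spaces $E,F$, $A\in\mathcal{A}(E)$, $u\in\mathcal{L}(E;F)$, and such that for all $n\in\mathbb{N}$ and Banach spaces $E_1,\dots,E_n,E$ with $E,E_j\in\mathcal{C}$ for some $j$: (i) every $A\in\mathcal{A}(E_1\widehat\otimes_\pi\cdots\widehat\otimes_\pi E_n)$ is contained in a finite union of sets $\overline{\mathrm{co}}(A_1\otimes\cdots\otimes A_n)$ with $A_j\in\mathcal{A}(E_j)$, $j=1,\dots,n$; (ii) if $A_j\in\mathcal{A}(E_j)$ for $j=1,\dots,n$, there is $A\in\mathcal{A}(E_1\widehat\otimes_\pi\cdots\widehat\otimes_\pi E_n)$ with $A_1\otimes\cdots\otimes A_n\subseteq A$; (iii) every $A\in\mathcal{A}(\widehat\otimes^n_{s,\pi}E)$ is contained in a finite union of sets $\overline{\mathrm{co}}(\otimes^n_sA')$ with $A'\in\mathcal{A}(E)$; (iv) if $A\in\mathcal{A}(E)$, there is $A'\in\mathcal{A}(\widehat\otimes^n_{s,\pi}E)$ with $\otimes^n_sA\subseteq A'$. $\tau_{\mathcal{A}}$ is the topology on $\mathcal{L}(E;F)$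 and $\mathcal{P}(^nE;F)$ of uniform convergence on sets of $\mathcal{A}(E)$, and on $\mathcal{L}(E_1,\dots,E_n;F)$ of uniform convergence on sets $A_1\times\cdots\times A_n$ with $A_j\in\mathcal{A}(E_j)$. $\overline{\mathcal{I}}^{\,\tau_{\mathcal{A}}}$ is the class with components $\overline{\mathcal{I}(E;F)}^{\,\tau_{\mathcal{A}}}$ (closure in $\mathcal{L}(E;F)$); it is an operator ideal for every operator ideal $\mathcal{I}$. For an operator ideal $\mathcal{I}$, $\mathcal{I}\circ\mathcal{L}(E_1,\dots,E_n;F)$ is the set of $n$-linear mappings of the form $u\circ B$ with $G$ a Banach space, $B\in\mathcal{L}(E_1,\dots,E_n;G)$ and $u\in\mathcal{I}(G;F)$. $\mathcal{L}[\mathcal{I}]$ is the class of all multilinear mappings $A\in\mathcal{L}(E_1,\dots,E_n;F)$ (any $n$, any Banach spaces) of the form $A=B\circ(u_1,\dots,u_n)$ with $G_1,\dots,G_n$ Banach spaces, $u_j\in\mathcal{I}(E_j;G_j)$ and $B\in\mathcal{L}(G_1,\dots,G_n;F)$. The inclusion $\mathcal{L}[\mathcal{I}]\subseteq\overline{\mathcal{I}}^{\,\tau_{\mathcal{A}}}\circ\mathcal{L}$ means inclusion of all components, for all $n$ and all Banach spaces. $\otimes^n\mathcal{J}(^nE;F)$ is the set of $A\in\mathcal{L}(^nE;F)$ of the form $A=B\circ(T_1,\dots,T_n)$ with $T_1,\dots,T_n\in\mathcal{J}(E;E)$ and $B\in\mathcal{L}(^nE;F)$. A Banach space $X$ has the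 $(\mathcal{J},\mathcal{I},\tau)$-weak approximation property ($(\mathcal{J},\mathcal{I},\tau)$-WAP) if $\mathcal{J}(X;X)\subseteq\overline{\mathcal{I}(X;X)}^{\,\tau}$. *)

(* Defs.v *)
From HB Require Import structures.
From mathcomp Require Import all_boot all_order all_algebra.
From mathcomp Require Import generic_quotient ring_quotient complex.
From mathcomp Require Import all_classical all_reals topology normedtype.
From mathcomp Require Import sequences convex.

Set Implicit Arguments.
Unset Strict Implicit.
Unset Printing Implicit Defensive.

Import Order.TTheory GRing.Theory Num.Theory.
Import numFieldNormedType.Exports.

Local Open Scope classical_set_scope.
Local Open Scope ring_scope.
Local Open Scope quotient_scope.

Variant scalar_kind := RealScalars | ComplexScalars.

Definition scalars (R : realType) (c : scalar_kind) : numFieldType :=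
  match c with RealScalars => R | ComplexScalars => R[i] end.

Section Scalars.
Variables (R : realType) (c : scalar_kind).
Local Notation K := (scalars R c).

Definition ofR : R -> K :=
  match c return R -> scalars R c with
  | RealScalars => id
  | ComplexScalars => fun x => (x%:C)%C
  end.

(* The modulus of a scalar, as a real number. *)
Definition modulus : K -> R :=
  match c return scalars R c -> R with
  | RealScalars => fun x => `|x|
  | ComplexScalars => fun x => complex.Re `|x|
  end.

Lemma ofR_modulus x : ofR (modulus x) = `|x|.
Proof. by rewrite /ofR /modulus; case: c x. Qed.

Lemma ofRD : {morph ofR : x y / x + y}.
Proof. by rewrite /ofR; case: c => //= x y; rewrite rmorphD. Qed.

Lemma ofRM : {morph ofR : x y / x * y}.
Proof. by rewrite /ofR; case: c => //= x y; rewrite rmorphM. Qed.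

Lemma ofR0 : ofR 0 = 0. Proof. by rewrite /ofR; case: c. Qed.

Lemma ofR1 : ofR 1 = 1. Proof. by rewrite /ofR; case: c. Qed.

Lemma ler_ofR : {mono ofR : x y / x <= y}.
Proof. by rewrite /ofR; case: c => //= x y; rewrite lecR. Qed.

Lemma ofR_inj : injective ofR.
Proof. exact: inc_inj ler_ofR. Qed.

Lemma ltr_ofR : {mono ofR : x y / x < y}.
Proof. by move=> x y; rewrite !lt_neqAle ler_ofR (inj_eq ofR_inj). Qed.

Lemma modulus_ge0 x : 0 <= modulus x.
Proof. by rewrite -ler_ofR ofR_modulus ofR0. Qed.

Lemma modulusM x y : modulus (x * y) = modulus x * modulus y.
Proof. by apply: ofR_inj; rewrite ofRM !ofR_modulus normrM. Qed.

Lemma modulus0 : modulus 0 = 0.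
Proof. by apply: ofR_inj; rewrite ofR_modulus ofR0 normr0. Qed.

Lemma modulus1 : modulus 1 = 1.
Proof. by apply: ofR_inj; rewrite ofR_modulus ofR1 normr1. Qed.

Lemma modulusN1 : modulus (-1) = 1.
Proof. by apply: ofR_inj; rewrite ofR_modulus ofR1 normrN1. Qed.

Lemma gt0_ofR (e : K) : 0 < e -> exists2 d : R, 0 < d & ofR d = e.
Proof.
move=> e0; exists (modulus e); last by rewrite ofR_modulus gtr0_norm.
by rewrite -ltr_ofR ofR0 ofR_modulus gtr0_norm.
Qed.

End Scalars.
Arguments ofR {R c}.
Arguments modulus {R c}.

Record seminorm (R : realType) (c : scalar_kind) (V : lmodType (scalars R c)) :=
  Seminorm {
    seminorm_fun :> V -> R;
    seminormD : forall x y,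
      seminorm_fun (x + y) <= seminorm_fun x + seminorm_fun y;
    seminormZ : forall a x, seminorm_fun (a *: x) = modulus a * seminorm_fun x
  }.

Section SeminormTheory.
Variables (R : realType) (c : scalar_kind) (V : lmodType (scalars R c)).
Variable p : seminorm V.

Lemma seminorm0 : p 0 = 0.
Proof. by rewrite -(scale0r 0) seminormZ modulus0 mul0r. Qed.

Lemma seminormN x : p (- x) = p x.
Proof. by rewrite -scaleN1r seminormZ modulusN1 mul1r. Qed.

Lemma seminormB x y : p (x - y) = p (y - x).
Proof. by rewrite -seminormN opprB. Qed.

Lemma seminorm_ge0 x : 0 <= p x.
Proof.
have := seminormD p x (- x); rewrite subrr seminorm0 seminormN.
by rewrite -mulr2n pmulrn_lge0.
Qed.

Lemma seminorm_dist x y : `|p x - p y| <= p (x - y).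
Proof.
have h u v : p u - p v <= p (u - v).
  by rewrite lerBlDr -{1}(subrK v u) seminormD.
by rewrite ler_norml h andbT lerNl opprB seminormB h.
Qed.

End SeminormTheory.

(* The Hausdorff completion of a seminormed space (V, p): Cauchy sequences
   modulo the sequences that tend to 0, with norm lim p(s n). *)
Section Completion.
Variables (R : realType) (c : scalar_kind) (V : lmodType (scalars R c)).
Variable p : seminorm V.
Local Notation K := (scalars R c).

Definition cauchy_pred : {pred nat -> V} := fun s => `[<
  forall e : R, 0 < e -> exists N, forall m n, (N <= m)%N -> (N <= n)%N ->
    p (s m - s n) < e >].

Lemma cauchy_pred_submod : submod_closed cauchy_pred.
Proof.
split.
  apply/asboolP => e e0; exists 0%N => m n _ _.
  by rewrite [X in p X](_ : _ = 0) ?seminorm0 // subrr.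
move=> a s t /asboolP cs /asboolP ct; apply/asboolP => e e0.
have d0 : 0 < e / 2 / (modulus a + 1).
  by rewrite !divr_gt0 // ltr_wpDl // modulus_ge0.
have [N1 h1] := cs _ d0; have [N2 h2] := ct _ (divr_gt0 e0 (ltr0Sn R 1)).
exists (maxn N1 N2) => m n; rewrite !geq_max => /andP[m1 m2] /andP[n1 n2].
rewrite [X in p X](_ : _ = a *: (s m - s n) + (t m - t n)); last first.
  by rewrite /= scalerBr opprD addrACA.
rewrite (le_lt_trans (seminormD _ _ _)) // [e]splitr ltr_leD //; last first.
  exact/ltW/h2.
rewrite seminormZ (@le_lt_trans _ _ ((modulus a + 1) * p (s m - s n))) //.
  by rewrite ler_wpM2r ?seminorm_ge0 // lerDl.
by rewrite mulrC -ltr_pdivlMr ?h1 // ltr_wpDl // modulus_ge0.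
Qed.

HB.instance Definition _ :=
  GRing.isSubmodClosed.Build K (nat -> V) cauchy_pred cauchy_pred_submod.

Record cauchy_seq := CauchySeq {
  cauchy_fun :> nat -> V;
  cauchy_seqP : cauchy_fun \in cauchy_pred }.

HB.instance Definition _ := [isSub for cauchy_fun].
HB.instance Definition _ := [Choice of cauchy_seq by <:].
HB.instance Definition _ := [SubChoice_isSubLmodule of cauchy_seq by <:].

Definition null_pred : {pred cauchy_seq} := fun s => `[<
  p (s n) @[n --> \oo] --> (0 : R) >].

Lemma null_pred_submod : submod_closed null_pred.
Proof.
split.
  apply/asboolP; apply: (@cvg_trans _ (nbhs (0 : R))) => //.
  rewrite (_ : (fun n : nat => _) = cst 0); first exact: cvg_cst.
  by apply/funext => n; rewrite [X in p X](_ : _ = 0) ?seminorm0.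
move=> a s t /asboolP ns /asboolP nt; apply/asboolP.
have h : modulus a * p (s n) + p (t n) @[n --> \oo] --> modulus a * 0 + 0.
  by apply: cvgD => //; apply: cvgM => //; exact: cvg_cst.
rewrite mulr0 addr0 in h.
apply: squeeze_cvgr (cvg_cst 0) h.
by apply: nearW => n; rewrite seminorm_ge0 -seminormZ seminormD.
Qed.

HB.instance Definition _ :=
  GRing.isSubmodClosed.Build K cauchy_seq null_pred null_pred_submod.

Definition completion := Quotient.quot null_pred.

HB.instance Definition _ := GRing.Zmodule.on completion.
HB.instance Definition _ := EqQuotient.on completion.

Lemma pi_completionD (s t : cauchy_seq) :
  \pi_completion (s + t) = \pi_completion s + \pi_completion t :> completion.
Proof. by rewrite !piE. Qed.

Lemma pi_completion_eq (s t : cauchy_seq) :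
  (\pi_completion s == \pi_completion t :> completion) =
  (s - t \in null_pred).
Proof. by rewrite -Quotient.idealrBE. Qed.

Definition completion_scale (a : K) (x : completion) : completion :=
  \pi_completion (a *: repr x).

Lemma pi_scale a (s : cauchy_seq) :
  completion_scale a (\pi_completion s) = \pi_completion (a *: s).
Proof.
apply/eqP; rewrite -Quotient.idealrBE -scalerBr rpredZ //.
by rewrite Quotient.idealrBE reprK.
Qed.

Lemma completion_scaleA a b x :
  completion_scale a (completion_scale b x) = completion_scale (a * b) x.
Proof. by rewrite -[x]reprK !pi_scale scalerA reprK. Qed.

Lemma completion_scale1 : left_id 1 completion_scale.
Proof. by move=> x; rewrite -[x]reprK pi_scale scale1r. Qed.

Lemma completion_scaleDr : right_distributive completion_scale +%R.
Proof.
move=> a x y; rewrite -[x]reprK -[y]reprK !pi_scale.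
by rewrite -!pi_completionD pi_scale scalerDr.
Qed.

Lemma completion_scaleDl x :
  {morph completion_scale^~ x : a b / a + b}.
Proof.
by move=> a b; rewrite -[x]reprK !pi_scale scalerDl pi_completionD.
Qed.

HB.instance Definition _ := GRing.Zmodule_isLmodule.Build K completion
  completion_scaleA completion_scale1 completion_scaleDr completion_scaleDl.

Lemma pi_completionZ a (s : cauchy_seq) :
  \pi_completion (a *: s) = a *: (\pi_completion s : completion).
Proof. by rewrite -pi_scale. Qed.

Lemma pi_completionB (s t : cauchy_seq) :
  \pi_completion (s - t) = \pi_completion s - \pi_completion t :> completion.
Proof. by apply/eqP; rewrite eq_sym subr_eq -pi_completionD subrK. Qed.

Lemma cauchy_seq_cvg (s : cauchy_seq) : cvgn (fun n => p (s n)).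
Proof.
apply/cauchy_cvgP; apply/cauchy_ballP => e e0; near_simpl.
have /asboolP /(_ e e0)[N hN] := cauchy_seqP s.
exists ([set n | N <= n]%N, [set n | N <= n]%N); first by split; exists N.
move=> [m n] [/= Nm Nn]; rewrite /ball /=.
exact: le_lt_trans (seminorm_dist _ _ _) (hN _ _ Nm Nn).
Qed.

Definition completion_norm (x : completion) : K :=
  ofR (limn (fun n => p (repr x n))).

Lemma completion_normE (s : cauchy_seq) :
  completion_norm (\pi_completion s) = ofR (limn (fun n => p (s n))).
Proof.
congr ofR; set r := repr _.
have : s - r \in null_pred by rewrite Quotient.idealrBE reprK.
move=> /asboolP h; apply/esym/cvg_lim => //.
rewrite -[X in _ --> X]addr0.
rewrite (_ : (fun n => p (s n)) =
  (fun n => p (r n) + (p (s n) - p (r n)))); last first.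
  by apply/funext => n; rewrite addrC subrK.
apply: cvgD; first exact: cauchy_seq_cvg.
apply/norm_cvg0P; apply: squeeze_cvgr (cvg_cst 0) h.
by apply: nearW => n; rewrite normr_ge0 seminorm_dist.
Qed.

Lemma completion_norm_triangle x y :
  completion_norm (x + y) <= completion_norm x + completion_norm y.
Proof.
rewrite -[x]reprK -[y]reprK -pi_completionD !completion_normE -ofRD ler_ofR.
rewrite -limD; try exact: cauchy_seq_cvg.
apply: ler_lim; first exact: cauchy_seq_cvg.
  by apply: is_cvgD; exact: cauchy_seq_cvg.
by apply: nearW => n; exact: seminormD.
Qed.

Lemma completion_normZ a x :
  completion_norm (a *: x) = `|a| * completion_norm x.
Proof.
rewrite -[x]reprK -pi_completionZ !completion_normE -ofR_modulus -ofRM.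
congr ofR; rewrite (_ : (fun n => _) =
  (fun n => modulus a * p ((repr x) n))); last first.
  by apply/funext => n; rewrite -seminormZ.
apply/cvg_lim => //; apply: cvgM; first exact: cvg_cst.
exact: cauchy_seq_cvg.
Qed.

Lemma completion_norm0_eq0 x : completion_norm x = 0 -> x = 0.
Proof.
rewrite -[x]reprK completion_normE -[RHS](ofR0 R c) => /ofR_inj h.
apply/eqP; rewrite -[0](_ : \pi_completion 0 = 0) ?piE //.
rewrite Quotient.equivE subr0; apply/asboolP; rewrite -h.
exact: cauchy_seq_cvg.
Qed.

HB.instance Definition _ := Lmodule_isNormed.Build K completion
  completion_norm_triangle completion_normZ completion_norm0_eq0.

Lemma cst_cauchy (v : V) : (fun _ : nat => v) \in cauchy_pred.
Proof.
by apply/asboolP => e e0; exists 0%N => m n _ _; rewrite subrr seminorm0.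
Qed.

Definition to_completion (v : V) : completion :=
  \pi_completion (CauchySeq (cst_cauchy v)).

Lemma to_completion_linear : linear to_completion.
Proof.
move=> a u v; rewrite /to_completion -pi_completionZ -pi_completionD.
by congr (\pi_completion _); apply/val_inj/funext => n.
Qed.

HB.instance Definition _ :=
  GRing.isLinear.Build K V completion _ to_completion to_completion_linear.

Lemma to_completion_norm v : `|to_completion v| = ofR (p v).
Proof.
rewrite [LHS]completion_normE; congr ofR.
by apply/cvg_lim => //=; exact: (@cvg_cst R).
Qed.

Lemma pi_to_completion_le (s : cauchy_seq) v (e : R) :
  (\forall n \near \oo, p (s n - v) <= e) ->
  `|\pi_completion s - to_completion v| <= ofR e.
Proof.
move=> h; rewrite -pi_completionB [leLHS]completion_normE ler_ofR.
apply: limr_le => //; exact: cauchy_seq_cvg.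
Qed.

Lemma to_completion_dense (x : completion) (e : R) : 0 < e ->
  exists v, `|x - to_completion v| < ofR e.
Proof.
move=> e0; rewrite -[x]reprK; set s := repr x.
have /asboolP /(_ (e / 2))[|N hN] := cauchy_seqP s; first exact: divr_gt0.
exists (s N); apply: (@le_lt_trans _ _ (ofR (e / 2))); last first.
  by rewrite ltr_ofR ltr_pdivrMr // ltr_pMr // ltr1n.
by apply: pi_to_completion_le; exists N => // n Nn; apply/ltW/hN.
Qed.

Lemma completion_complete (F : set_system completion) :
  ProperFilter F -> cauchy F -> cvg F.
Proof.
move=> FF Fc.
have /choice[v hv] (n : nat) : exists v : V,
    F [set y | `|y - to_completion v| < ofR (2 / n.+1%:R)].
  have d0 : 0 < n.+1%:R^-1 :> R by rewrite invr_gt0.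
  have dK : 0 < ofR n.+1%:R^-1 :> K by rewrite -(ofR0 R c) ltr_ofR.
  have [x Fx] := (cauchyP F).1 Fc _ dK.
  have [v xv] := to_completion_dense x d0; exists v.
  apply: filterS Fx => y; rewrite -ball_normE /= => xy.
  rewrite (le_lt_trans (ler_distD x _ _)) //.
  by rewrite mulr_natl mulr2n ofRD ltrD // distrC.
have vB m n : p (v m - v n) < 2 / m.+1%:R + 2 / n.+1%:R.
  rewrite -(ltr_ofR c) -to_completion_norm linearB ofRD.
  have [y [ym yn]] := filter_ex (filterI (hv m) (hv n)).
  by rewrite (le_lt_trans (ler_distD y _ _)) // ltrD // distrC.
have inv0 (e : R) : 0 < e -> exists N, forall n, (N <= n)%N -> 2 / n.+1%:R < e.
  move=> e0; exists (Num.truncn (2 / e)) => n Nn.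
  rewrite ltr_pdivrMr // mulrC -ltr_pdivrMr //.
  by rewrite (lt_le_trans (truncnS_gt _)) // ler_nat.
have vc : v \in cauchy_pred.
  apply/asboolP => e e0; have [N hN] := inv0 _ (divr_gt0 e0 (ltr0Sn R 1)).
  exists N => m n Nm Nn; rewrite (lt_trans (vB _ _)) // [e]splitr.
  by rewrite ltrD // hN.
apply/cvg_ex; exists (\pi_completion (CauchySeq vc)).
apply/cvgrPdist_lt => /= e /gt0_ofR[d d0 <-].
have [N hN] := inv0 _ (divr_gt0 (divr_gt0 d0 (ltr0Sn R 1)) (ltr0Sn R 1)).
apply: filterS (hv N) => y /= yN.
have h : `|\pi_completion (CauchySeq vc) - to_completion (v N)|
    <= ofR (2 / N.+1%:R + 2 / N.+1%:R).
  apply: pi_to_completion_le; exists N => // n Nn.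
  rewrite (le_trans (ltW (vB _ _))) // lerD2r ler_pM2l // lef_pV2 ?posrE //.
  by rewrite ler_nat.
rewrite (le_lt_trans (ler_distD (to_completion (v N)) _ _)) // (@lt_trans _ _
  (ofR (2 / N.+1%:R + 2 / N.+1%:R) + ofR (2 / N.+1%:R))) //.
  by rewrite ler_ltD // distrC.
have hd : 2 / N.+1%:R < d / 2 / 2 by exact: hN.
rewrite -ofRD ltr_ofR [d]splitr ltrD //.
  by rewrite [d / 2]splitr ltrD.
by rewrite (lt_trans hd) // ltr_pdivrMr // ltr_pMr ?divr_gt0 // ltr1n.
Qed.

HB.instance Definition _ :=
  Uniform_isComplete.Build completion completion_complete.

End Completion.

(* The linear span of a family g : X -> W, and the seminorm
     u |-> inf { sum_l |a_l| w(x_l) : u = sum_l a_l g(x_l) }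
   on it.  With X a product of Banach spaces, g(x) = x_1 (x) ... (x) x_n and
   w(x) = ||x_1|| ... ||x_n|| this is the projective norm pi; with X a Banach
   space, g(x) = x (x) ... (x) x and w(x) = ||x||^n it is pi_s. *)
Section SpanSeminorm.
Variables (R : realType) (c : scalar_kind) (W : lmodType (scalars R c)).
Variables (X : Type) (g : X -> W) (w : X -> R).
Hypothesis w_ge0 : forall x, 0 <= w x.
Local Notation K := (scalars R c).

Definition lincomb (s : seq (K * X)) : W := \sum_(a <- s) a.1 *: g a.2.
Definition cost (s : seq (K * X)) : R := \sum_(a <- s) modulus a.1 * w a.2.

Definition span_pred : {pred W} := fun u => `[< exists s, u = lincomb s >].

Let scale_seq (a : K) (s : seq (K * X)) := [seq (a * b.1, b.2) | b <- s].

Let lincombZ a s : lincomb (scale_seq a s) = a *: lincomb s.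
Proof.
rewrite /lincomb big_map scaler_sumr.
by apply: eq_bigr => b _; rewrite scalerA.
Qed.

Let costZ a s : cost (scale_seq a s) = modulus a * cost s.
Proof.
rewrite /cost big_map mulr_sumr.
by apply: eq_bigr => b _; rewrite modulusM mulrA.
Qed.

Let lincomb_cat s t : lincomb (s ++ t) = lincomb s + lincomb t.
Proof. exact: big_cat. Qed.

Let cost_cat s t : cost (s ++ t) = cost s + cost t.
Proof. exact: big_cat. Qed.

Let cost_ge0 s : 0 <= cost s.
Proof. by apply: sumr_ge0 => a _; rewrite mulr_ge0 ?modulus_ge0. Qed.

Lemma span_pred_submod : submod_closed span_pred.
Proof.
split; first by apply/asboolP; exists [::]; rewrite /lincomb big_nil.
move=> a u v /asboolP[s ->] /asboolP[t ->]; apply/asboolP.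
by exists (scale_seq a s ++ t); rewrite lincomb_cat lincombZ.
Qed.

HB.instance Definition _ :=
  GRing.isSubmodClosed.Build K W span_pred span_pred_submod.

Record lspan := LSpan { lspan_val :> W; lspan_valP : lspan_val \in span_pred }.

HB.instance Definition _ := [isSub for lspan_val].
HB.instance Definition _ := [Choice of lspan by <:].
HB.instance Definition _ := [SubChoice_isSubLmodule of lspan by <:].

Lemma gen_in_span x : g x \in span_pred.
Proof.
apply/asboolP; exists [:: (1, x)].
by rewrite /lincomb big_seq1 scale1r.
Qed.

Definition span_gen (x : X) : lspan := LSpan (gen_in_span x).

Definition span_norm (u : lspan) : R :=
  inf [set cost s | s in [set s | lspan_val u = lincomb s]].

Let costs_nonempty (u : lspan) :
  [set cost s | s in [set s | lspan_val u = lincomb s]] !=set0.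
Proof. by have /asboolP[s us] := lspan_valP u; exists (cost s), s. Qed.

Let costs_lbound (u : lspan) :
  has_lbound [set cost s | s in [set s | lspan_val u = lincomb s]].
Proof. by exists 0 => _ [s _ <-]; exact: cost_ge0. Qed.

Lemma span_norm_le (u : lspan) s : lspan_val u = lincomb s -> span_norm u <= cost s.
Proof. by move=> us; apply: ge_inf => //; exists s. Qed.

Lemma span_norm_lt (u : lspan) e : 0 < e ->
  exists2 s, lspan_val u = lincomb s & cost s < span_norm u + e.
Proof.
move=> e0.
have hi := conj (costs_nonempty u) (costs_lbound u).
by have [_ [s us <-] h] := inf_adherent e0 hi; exists s.
Qed.

Lemma span_normD u v : span_norm (u + v) <= span_norm u + span_norm v.
Proof.
apply/ler_addgt0Pr => e e0; have e2 : 0 < e / 2 by rewrite divr_gt0.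
have [s us hs] := span_norm_lt u e2; have [t vt ht] := span_norm_lt v e2.
rewrite (le_trans (@span_norm_le _ (s ++ t) _)) //.
  by rewrite lincomb_cat -us -vt.
by rewrite cost_cat [e]splitr addrACA lerD // ltW.
Qed.

Let span_normZ_le a u : span_norm (a *: u) <= modulus a * span_norm u.
Proof.
apply/ler_addgt0Pr => e e0.
have m0 : 0 < modulus a + 1 by rewrite ltr_wpDl ?modulus_ge0.
have [s us hs] := span_norm_lt u (divr_gt0 e0 m0).
rewrite (le_trans (@span_norm_le _ (scale_seq a s) _)) //.
  by rewrite lincombZ -us.
rewrite costZ (le_trans (ler_wpM2l (modulus_ge0 a) (ltW hs))) // mulrDr lerD2l.
by rewrite mulrCA ger_pMr // ler_pdivrMr // mul1r lerDl.
Qed.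

Lemma span_normZ a u : span_norm (a *: u) = modulus a * span_norm u.
Proof.
apply/eqP; rewrite eq_le span_normZ_le /=.
have [->|a0] := eqVneq a 0.
  rewrite modulus0 mul0r; apply: lb_le_inf; first exact: costs_nonempty.
  by move=> _ [s _ <-]; exact: cost_ge0.
have := span_normZ_le a^-1 (a *: u).
rewrite scalerA mulVf // scale1r => h.
rewrite (le_trans (ler_wpM2l (modulus_ge0 a) h)) // mulrA -modulusM.
by rewrite mulfV // modulus1 mul1r.
Qed.

Definition span_seminorm : seminorm lspan := Seminorm span_normD span_normZ.

End SpanSeminorm.

Arguments to_completion {R c V} p.
Arguments span_gen {R c W X} g.

Section TensorProducts.
Variables (R : realType) (c : scalar_kind).
Local Notation K := (scalars R c).
Local Notation banach := (completeNormedModType (scalars R c)).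

Definition multilinear n (E : 'I_n -> lmodType K) (F : lmodType K)
    (B : (forall i, E i) -> F) :=
  forall (x : forall i, E i) (i : 'I_n), linear (fun y : E i => B (dfwith x i y)).

Definition rnorm (E : banach) (x : E) : R := modulus `|x|.

Lemma rnorm_ge0 (E : banach) (x : E) : 0 <= rnorm x.
Proof. exact: modulus_ge0. Qed.

(* The algebraic tensor product is realised as a space of linear functionals
   on n-linear forms, with x_1 (x) ... (x) x_n : B |-> B(x_1, ..., x_n). *)
Section Projective.
Variables (n : nat) (E : 'I_n -> banach).

Definition mform := {B : (forall i, E i) -> K^o | multilinear B}.

Definition atens (x : forall i, E i) : mform -> K^o := fun B => sval B x.

Definition pi_weight (x : forall i, E i) : R := \prod_(i < n) rnorm (x i).

Lemma pi_weight_ge0 x : 0 <= pi_weight x.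
Proof. by apply: prodr_ge0 => i _; exact: rnorm_ge0. Qed.

Definition proj_seminorm : seminorm (lspan atens) :=
  span_seminorm atens pi_weight_ge0.

Definition ptensor : banach := completion proj_seminorm.

Definition ptens (x : forall i, E i) : ptensor :=
  to_completion proj_seminorm (span_gen atens x).

Lemma ptens_multilinear : multilinear ptens.
Proof.
move=> x i a y z; rewrite /ptens -linearP; congr to_completion.
by apply/val_inj/funext => -[B mB] /=; exact: mB.
Qed.

Lemma ptens_norm_le x : `|ptens x| <= \prod_(i < n) `|x i|.
Proof.
rewrite to_completion_norm (@le_trans _ _ (ofR (pi_weight x))) //.
  have xE : lspan_val (span_gen atens x) = lincomb atens [:: (1, x)].
    by rewrite /lincomb big_seq1 scale1r.
  rewrite ler_ofR (le_trans (span_norm_le pi_weight_ge0 xE)) //.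
  by rewrite /cost big_seq1 modulus1 mul1r.
rewrite /pi_weight (big_morph ofR (@ofRM _ _) (ofR1 _ _)).
by apply: ler_prod => i _; rewrite /rnorm ofR_modulus normr_id normr_ge0 /=.
Qed.

End Projective.

Definition ptensor_pow n (E : banach) : banach := ptensor (fun _ : 'I_n => E).

Section SymmetricProjective.
Variables (n : nat) (E : banach).

Definition satens (x : E) : mform (fun _ : 'I_n => E) -> K^o :=
  atens (fun=> x).

Definition pi_s_weight (x : E) : R := rnorm x ^+ n.

Lemma pi_s_weight_ge0 x : 0 <= pi_s_weight x.
Proof. by rewrite exprn_ge0 // rnorm_ge0. Qed.

Definition sproj_seminorm : seminorm (lspan satens) :=
  span_seminorm satens pi_s_weight_ge0.

Definition stensor : banach := completion sproj_seminorm.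

Definition stens (x : E) : stensor :=
  to_completion sproj_seminorm (span_gen satens x).

End SymmetricProjective.

End TensorProducts.

Unset Implicit Arguments.

Section Ideals.
Context {R : realType} {c : scalar_kind}.
Local Notation K := (scalars R c).
Local Notation banach := (completeNormedModType (scalars R c)).

Definition bounded_op {E F : banach} (u : E -> F) := linear u /\ continuous u.

Definition cont_multilinear {n} {E : 'I_n -> banach} {F : banach}
    (B : (forall i, E i) -> F) :=
  multilinear B /\ continuous (B : prod_topology (fun i => E i) -> F).

Definition finite_rank {E F : banach} (u : E -> F) :=
  exists m (y : 'I_m -> F), forall x, exists a : 'I_m -> K,
    u x = \sum_(i < m) a i *: y i.

Definition operator_class := forall E F : banach, set (E -> F).

Record operator_ideal (I : operator_class) : Prop := {
  ideal_sub : forall E F : banach, I E F `<=` bounded_op;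
  ideal_lincomb : forall (E F : banach) (a : K) (u v : E -> F),
    I E F u -> I E F v -> I E F (fun x => a *: u x + v x);
  ideal_finite_rank : forall (E F : banach) (u : E -> F),
    bounded_op u -> finite_rank u -> I E F u;
  ideal_comp : forall (E0 E F F0 : banach) (u : E0 -> E) (v : E -> F) (w : F -> F0),
    bounded_op u -> I E F v -> bounded_op w ->
    I E0 F0 (w \o v \o u) }.

Definition set_assignment := forall E : banach, set (set E).

Definition closed_conv {E : banach} (S : set E) : set E :=
  closure (smallest (@convex_set K E) S).

Definition tens_set {n} {E : 'I_n -> banach} (S : forall i, set (E i)) :
    set (ptensor E) :=
  [set ptens x | x in [set x | forall i, S i (x i)]].

Definition stens_set n {E : banach} (S : set E) : set (stensor n E) :=
  [set stens n x | x in S].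

Record admissible (C : banach -> Prop) (A : set_assignment) : Prop := {
  adm_bounded : forall (E : banach) S, A E S -> bounded_set S;
  adm_singleton : forall (E : banach) (x : E), A E [set x];
  adm_image : forall (E F : banach) (S : set E) (u : E -> F),
    A E S -> bounded_op u -> A F (u @` S);
  adm_tensor : forall n (Es : 'I_n -> banach) (E : banach), (0 < n)%N ->
    C E -> (exists j, C (Es j)) ->
    [/\ forall S, A (ptensor Es) S ->
          exists m (T : 'I_m -> forall j, set (Es j)),
            (forall l j, A (Es j) (T l j)) /\
            S `<=` \bigcup_(l in [set: 'I_m]) closed_conv (tens_set (T l)),
        forall T : forall j, set (Es j), (forall j, A (Es j) (T j)) ->
          exists2 S, A (ptensor Es) S & tens_set T `<=` S,
        forall S, A (stensor n E) S ->
          exists m (T : 'I_m -> set E),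
            (forall l, A E (T l)) /\
            S `<=` \bigcup_(l in [set: 'I_m]) closed_conv (stens_set n (T l))
      & forall T, A E T ->
          exists2 S, A (stensor n E) S & stens_set n T `<=` S] }.

Definition union_directed (A : set_assignment) :=
  forall (E : banach) S1 S2, A E S1 -> A E S2 ->
    exists2 S, A E S & S1 `|` S2 `<=` S.

(* The closure in L(E; F) for the topology of uniform convergence on the
   members of A(E). *)
Definition tau_closure (A : set_assignment) (I : operator_class) :
    operator_class := fun E F =>
  bounded_op `&` closure (I E F : set {family A E, E -> F}).

(* The next three definitions are the components of I o L, of L[I] and of
   (x)^n J. *)
Definition comp_left (I : operator_class) {n} (E : 'I_n -> banach) (F : banach) :
    set ((forall i, E i) -> F) :=
  [set f | exists (G : banach) (B : (forall i, E i) -> G) (u : G -> F),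
    [/\ cont_multilinear B, I G F u & f = u \o B]].

Definition comp_right (I : operator_class) {n} (E : 'I_n -> banach)
    (F : banach) : set ((forall i, E i) -> F) :=
  [set f | exists (G : 'I_n -> banach) (u : forall i, E i -> G i)
      (B : (forall i, G i) -> F),
    [/\ forall i, I (E i) (G i) (u i), cont_multilinear B
      & f = fun x => B (fun i => u i (x i))]].

Definition comp_right_endo (J : operator_class) n (E F : banach) :
    set (('I_n -> E) -> F) :=
  [set f | exists (T : 'I_n -> E -> E) (B : ('I_n -> E) -> F),
    [/\ forall i, J E E (T i), cont_multilinear (E := fun=> E) B
      & f = fun x => B (fun i => T i (x i))]].

Definition WAP (J I : operator_class) (A : set_assignment) (X : banach) :=
  J X X `<=` tau_closure A I X X.

End Ideals.

Arguments operator_class : clear implicits.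
Arguments set_assignment : clear implicits.

(* Main.v *)
(** The weak approximation property passes to bounded retracts.  With phi a
   bounded functional and phi(e) = 1, the k-th tensor power is a retract of the
   n-th one for k <= n (tensor with copies of e, contract with copies of phi);
   the symmetric power is a retract of the full one by polarization; and E is a
   retract of its symmetric powers: symmetrising x (x) e (x) ... (x) e and
   contracting with phi gives alpha x + beta phi(x) e with alpha > 0 and
   beta >= 0, which is invertible.  So everything reduces to passing from E to
   the full n-th power.  There an operator T in J satisfies
   T(x_1 (x) ... (x) x_n) = B(T_1 x_1, ..., T_n x_n) with T_j in J(E; E);
   replacing each T_j by a nearby U_j in I yields a mapping in L[I], which by
   hypothesis linearises to an operator in the closure of I. *)
Require Import Defs.
From mathcomp Require Import all_boot all_order all_algebra ring lra complex.
From mathcomp Require Import all_classical all_reals topology normedtype.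
From mathcomp Require Import interval_inference sequences convex.

Set Implicit Arguments.
Unset Strict Implicit.
Unset Printing Implicit Defensive.

Import Order.TTheory GRing.Theory Num.Theory.
Import numFieldNormedType.Exports.

Local Open Scope classical_set_scope.
Local Open Scope ring_scope.

(** * Real-valued norms and bounded operators *)

Section RealNorm.
Variables (R : realType) (c : scalar_kind).
Local Notation K := (scalars R c).
Local Notation banach := (completeNormedModType K).

(** Two obstacles shape the proof. Elementary tensors are tested on scalar forms only, whereas the
    mappings to be linearised are vector-valued. That such a mapping respects the relations among
    tensors is a separation argument, so Hahn-Banach is used for linearisation as well as for phi,
    over both scalar fields. The zero space carries no phi and is treated separately. The error of
    replacing all T_j at once must also be uniform. A set in the tensor power is covered by finitely
    many hulls, each with its own factors. Directedness of the assignment merges these factors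
    coordinate by coordinate, so that one U_j serves all hulls; boundedness of the merged sets gives
    a Lipschitz constant for B that does not depend on the U_j. *)

Lemma modulus_ofR (x : R) : 0 <= x -> modulus (ofR x : K) = x.
Proof.
move=> x0; apply: (@ofR_inj R c); rewrite ofR_modulus ger0_norm //.
by rewrite -(ofR0 R c) ler_ofR.
Qed.

Lemma rnormE (E : banach) (x : E) : `|x| = ofR (rnorm x).
Proof. by rewrite /rnorm ofR_modulus normr_id. Qed.

Lemma rnormD (E : banach) (x y : E) : rnorm (x + y) <= rnorm x + rnorm y.
Proof. by rewrite -(ler_ofR c) ofRD -!rnormE ler_normD. Qed.

Lemma rnormZ (E : banach) (a : K) (x : E) :
  rnorm (a *: x) = modulus a * rnorm x.
Proof.
by apply: (@ofR_inj R c); rewrite ofRM -!rnormE normrZ ofR_modulus.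
Qed.

Definition rnorm_seminorm (E : banach) : seminorm E :=
  Seminorm (@rnormD E) (@rnormZ E).

Lemma rnorm0 (E : banach) : rnorm (0 : E) = 0.
Proof. exact: (seminorm0 (rnorm_seminorm E)). Qed.

Lemma rnormN (E : banach) (x : E) : rnorm (- x) = rnorm x.
Proof. exact: (seminormN (rnorm_seminorm E)). Qed.

Lemma rnorm_distC (E : banach) (x y : E) : rnorm (x - y) = rnorm (y - x).
Proof. exact: (seminormB (rnorm_seminorm E)). Qed.

Lemma rnorm_distD (E : banach) (z x y : E) :
  rnorm (x - y) <= rnorm (x - z) + rnorm (z - y).
Proof. by rewrite (le_trans _ (rnormD _ _)) // addrA subrK. Qed.

Lemma rnorm_eq0 (E : banach) (x : E) : rnorm x = 0 -> x = 0.
Proof. by move=> x0; apply: normr0_eq0; rewrite rnormE x0 ofR0. Qed.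

Lemma rnorm_sum (E : banach) (T : Type) (s : seq T) (P : pred T) (f : T -> E) :
  rnorm (\sum_(i <- s | P i) f i) <= \sum_(i <- s | P i) rnorm (f i).
Proof.
elim/big_rec2: _ => [|i x y _ h]; first by rewrite rnorm0.
by rewrite (le_trans (rnormD _ _)) // lerD2l.
Qed.

Lemma rnorm_to_completion (V : lmodType K) (p : seminorm V) v :
  rnorm (to_completion p v) = p v.
Proof. by apply: (@ofR_inj R c); rewrite -rnormE to_completion_norm. Qed.

Lemma completion_approx (V : lmodType K) (p : seminorm V) (x : completion p)
    (e : R) : 0 < e -> exists v, rnorm (x - to_completion p v) < e.
Proof.
move=> /(to_completion_dense x)[v hv]; exists v.
by rewrite -(ltr_ofR c) -rnormE.
Qed.

Lemma continuous_rnormP (E F : banach) (u : E -> F) (x : E) :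
  {for x, continuous u} <->
  forall e : R, 0 < e -> exists2 d : R, 0 < d &
    forall y, rnorm (x - y) < d -> rnorm (u x - u y) < e.
Proof.
split=> [ux e e0|h].
  have eK : 0 < ofR e :> K by rewrite -(ofR0 R c) ltr_ofR.
  have /cvgrPdist_lt /(_ _ eK) /nbhs_normP[_ /= /gt0_ofR[d d0 <-] hd] := ux.
  exists d => // y xy; rewrite -(ltr_ofR c) -rnormE; apply: hd => /=.
  by rewrite /ball_ rnormE ltr_ofR.
apply/cvgrPdist_lt => /= _ /gt0_ofR[e e0 <-].
have [d d0 hd] := h e e0.
apply/nbhs_normP; exists (ofR d); first by rewrite /= -(ofR0 R c) ltr_ofR.
by move=> y /=; rewrite !rnormE !ltr_ofR; exact: hd.
Qed.

Section LinearFun.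
Variables (E F : lmodType K) (u : E -> F).
Hypothesis lu : linear u.

Lemma linear_fun0 : u 0 = 0.
Proof. by have := lu (-1) 0 0; rewrite scaler0 add0r scaleN1r addNr. Qed.

Lemma linear_funZ a x : u (a *: x) = a *: u x.
Proof. by have := lu a x 0; rewrite !addr0 linear_fun0 addr0. Qed.

Lemma linear_funD x y : u (x + y) = u x + u y.
Proof. by have := lu 1 x y; rewrite !scale1r. Qed.

Lemma linear_funN x : u (- x) = - u x.
Proof. by rewrite -[- x]scaleN1r linear_funZ scaleN1r. Qed.

Lemma linear_funB x y : u (x - y) = u x - u y.
Proof. by rewrite linear_funD linear_funN. Qed.

Lemma linear_fun_sum (T : Type) (s : seq T) (P : pred T) (f : T -> E) :
  u (\sum_(i <- s | P i) f i) = \sum_(i <- s | P i) u (f i).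
Proof. exact: (big_morph u linear_funD linear_fun0). Qed.

End LinearFun.

Lemma bounded_opP (E F : banach) (u : E -> F) :
  bounded_op u <->
  linear u /\ exists2 M, 0 <= M & forall x, rnorm (u x) <= M * rnorm x.
Proof.
split=> [[lu h]|[lu [M M0 h]]]; split=> //.
  have [d d0 hd] := (continuous_rnormP u 0).1 (h 0) 1 ltr01.
  have d2 : 0 < 2 / d by rewrite divr_gt0.
  exists (2 / d) => [|x]; first exact: ltW.
  have [x0|x0] := eqVneq (rnorm x) 0.
    by rewrite x0 mulr0 (rnorm_eq0 x0) (linear_fun0 lu) rnorm0.
  have {}x0 : 0 < rnorm x by rewrite lt_neqAle eq_sym x0 rnorm_ge0.
  (* Rescaling [x] to norm d / 2 puts it inside the open ball; this is the origin of the bound 2 /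
     d. *)
  have t0 : 0 < d / 2 / rnorm x by rewrite !divr_gt0.
  have := hd (ofR (d / 2 / rnorm x) *: x).
  rewrite (linear_fun0 lu) !sub0r !rnormN (linear_funZ lu) !rnormZ.
  rewrite modulus_ofR ?(ltW t0) // divfK ?gt_eqF //.
  have dd : d / 2 < d by lra.
  move=> /(_ dd)/ltW.
  by rewrite -ler_pdivlMl // invf_div mulr1 invf_div mulrC.
move=> x; apply/continuous_rnormP => e e0; exists (e / (M + 1)).
  by rewrite divr_gt0 // ltr_wpDl.
move=> y; rewrite ltr_pdivlMr ?ltr_wpDl // => hxy.
rewrite -(linear_funB lu) (le_lt_trans (h _)) // (le_lt_trans _ hxy) // mulrC.
by rewrite ler_wpM2l ?rnorm_ge0 // lerDl.
Qed.

End RealNorm.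

(** * Extension of bounded linear maps to a completion *)

Section CompletionExtension.
Variables (R : realType) (c : scalar_kind).
Local Notation K := (scalars R c).
Local Notation banach := (completeNormedModType K).

Lemma rnorm_cauchy_seq_cvg (F : banach) (s : nat -> F) :
  (forall e : R, 0 < e -> exists N, forall m n, (N <= m)%N -> (N <= n)%N ->
    rnorm (s m - s n) < e) ->
  exists y, forall e : R, 0 < e -> exists N, forall n, (N <= n)%N ->
    rnorm (y - s n) < e.
Proof.
move=> h; have : cvg (s @ \oo).
  apply/cauchy_cvgP/cauchyP => _ /= /gt0_ofR[e e0 <-].
  have [N hN] := h e e0; exists (s N); exists N => // n Nn /=.
  by rewrite -ball_normE /= rnormE ltr_ofR hN.
move=> /cvg_ex[/= y /cvgrPdist_lt hy]; exists y => e e0.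
have eK : 0 < ofR e :> K by rewrite -(ofR0 R c) ltr_ofR.
have [N _ hN] := hy _ eK; exists N => n Nn.
by have := hN n Nn; rewrite /= rnormE ltr_ofR.
Qed.

Variables (V : lmodType K) (p : seminorm V) (F : banach).
Variables (f : V -> F) (M : R).
Hypotheses (lf : linear f) (M0 : 0 <= M).
Hypothesis hf : forall v, rnorm (f v) <= M * p v.

(** The graph of the extension, as the closure of the graph of [f]. Linearity and the norm bound
    pass to it from the approximants; the bound at 0 makes it single-valued, and completeness of [F]
    makes it total. *)
Let near_graph (x : completion p) (y : F) := forall e : R, 0 < e ->
  exists v, rnorm (x - to_completion p v : completion p) < e /\ rnorm (y - f v) < e.

Let near_graph_bound x y : near_graph x y -> rnorm y <= M * rnorm x.
Proof.
move=> xy; apply/ler_addgt0Pr => e e0.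
have d0 : 0 < e / (M + 1) by rewrite divr_gt0 // ltr_wpDl.
have [v [hx hy]] := xy _ d0.
rewrite -(subrK (f v) y) (le_trans (rnormD _ _)) //.
rewrite (le_trans (lerD (ltW hy) (hf v))) //.
have pv : p v <= rnorm x + e / (M + 1).
  rewrite -rnorm_to_completion -[X in rnorm X](subrK x).
  by rewrite (le_trans (rnormD _ _)) // addrC lerD2l rnorm_distC ltW.
rewrite (le_trans (lerD (lexx _) (ler_wpM2l M0 pv))) //.
rewrite mulrDr addrCA lerD2l -{1}[e / _]mul1r -mulrDl addrC.
by rewrite mulrC divfK // gt_eqF // ltr_wpDl.
Qed.

Let near_graph_linear a x y x' y' : near_graph x y -> near_graph x' y' ->
  near_graph (a *: x + x') (a *: y + y').
Proof.
move=> xy xy' e e0; have m0 : 0 < modulus a + 1.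
  by rewrite ltr_wpDl // modulus_ge0.
have d0 : 0 < e / 2 / (modulus a + 1) by rewrite !divr_gt0.
have e2 : 0 < e / 2 by rewrite divr_gt0.
have key (G : banach) (u v u' v' : G) : rnorm (u - v) < e / 2 / (modulus a + 1) ->
    rnorm (u' - v') < e / 2 -> rnorm (a *: u + u' - (a *: v + v')) < e.
  move=> h h'; rewrite opprD addrACA -scalerBr [e]splitr.
  rewrite (le_lt_trans (rnormD _ _)) // ler_ltD // rnormZ.
  rewrite (@le_trans _ _ ((modulus a + 1) * rnorm (u - v))) //.
    by rewrite ler_wpM2r ?rnorm_ge0 // lerDl.
  by rewrite mulrC -ler_pdivlMr // ltW.
have [v [hx hy]] := xy _ d0; have [v' [hx' hy']] := xy' _ e2.
exists (a *: v + v'); split; last by rewrite lf; exact: key.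
by rewrite linearP; exact: key.
Qed.

Let near_graph_ex x : exists y, near_graph x y.
Proof.
have /choice[v hv] (n : nat) :
    exists v, rnorm (x - to_completion p v : completion p) < n.+1%:R^-1.
  by apply: completion_approx; rewrite invr_gt0.
have inv0 (e : R) : 0 < e -> exists N, forall n, (N <= n)%N -> n.+1%:R^-1 < e.
  move=> e0; exists (Num.truncn e^-1) => n Nn.
  rewrite invf_plt ?posrE //.
  by rewrite (lt_le_trans (truncnS_gt _)) // ler_nat.
have [e e0|y hy] := @rnorm_cauchy_seq_cvg F (f \o v).
  have e'0 : 0 < e / 2 / (M + 1) by rewrite !divr_gt0 // ltr_wpDl.
  have [N hN] := inv0 _ e'0; exists N => m n Nm Nn /=.
  rewrite -(linear_funB lf) (le_lt_trans (hf _)) //.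
  rewrite -rnorm_to_completion linearB.
  have hmn : rnorm (to_completion p (v m) - to_completion p (v n) : completion p)
      < e / (M + 1).
    rewrite (le_lt_trans (rnorm_distD x _ _)) //.
    rewrite (_ : e / (M + 1) = e / 2 / (M + 1) + e / 2 / (M + 1)); last first.
      by rewrite -mulrDl -splitr.
    by rewrite ltrD // ?[rnorm (to_completion _ _ - _)]rnorm_distC (lt_trans (hv _)) // hN.
  rewrite ltr_pdivlMr ?ltr_wpDl // in hmn.
  rewrite (le_lt_trans _ hmn) // mulrC.
  by rewrite ler_wpM2l ?rnorm_ge0 // lerDl.
exists y => e e0; have [N hN] := hy e e0; have [N' hN'] := inv0 e e0.
exists (v (maxn N N')); split; last by apply: hN; rewrite leq_maxl.
by apply: lt_trans (hv _) _; apply: hN'; rewrite leq_maxr.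
Qed.

Lemma completion_extension : exists u : completion p -> F,
  [/\ linear u, forall x, rnorm (u x) <= M * rnorm x
    & forall v, u (to_completion p v) = f v].
Proof.
have /choice[u hu] := near_graph_ex.
have uniq x y y' : near_graph x y -> near_graph x y' -> y = y'.
  move=> h h'; have := near_graph_bound (near_graph_linear (-1) h h').
  rewrite !scaleN1r !addNr rnorm0 mulr0 addrC => le0.
  apply/esym/eqP; rewrite -subr_eq0; apply/eqP/rnorm_eq0/le_anti.
  by rewrite le0 rnorm_ge0.
exists u; split=> [a x x'|x|v].
- by apply: (uniq (a *: x + x')) => //; apply: near_graph_linear.
- exact: near_graph_bound.
apply: (uniq (to_completion p v)) => // e e0; exists v.
by rewrite !subrr !rnorm0.
Qed.

End CompletionExtension.

Section BoundedOperators.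
Variables (R : realType) (c : scalar_kind).
Local Notation K := (scalars R c).
Local Notation banach := (completeNormedModType K).

Lemma completion_op_eq (V : lmodType K) (p : seminorm V) (F : banach)
    (u v : completion p -> F) : bounded_op u -> bounded_op v ->
  (forall x, u (to_completion p x) = v (to_completion p x)) -> u =1 v.
Proof.
move=> /bounded_opP[lu [M M0 hu]] /bounded_opP[lv [N N0 hv]] uv x.
apply/eqP; rewrite -subr_eq0; apply/eqP/rnorm_eq0/le_anti.
rewrite rnorm_ge0 andbT; apply/ler_addgt0Pr => e e0; rewrite add0r.
have MN : 0 < M + N + 1 by rewrite ltr_wpDl // addr_ge0.
have [y hy] := completion_approx x (divr_gt0 e0 MN).
rewrite (le_trans (rnorm_distD (u (to_completion p y)) _ _)) //.
rewrite {2}uv -(linear_funB lu) -(linear_funB lv).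
rewrite (le_trans (lerD (hu _) (hv _))) // [rnorm (_ - x)]rnorm_distC.
rewrite ltr_pdivlMr // in hy; rewrite (le_trans _ (ltW hy)) // -mulrDl [X in X <= _]mulrC.
by rewrite ler_wpM2l ?rnorm_ge0 // lerDl.
Qed.

Lemma bounded_op_comp (E F G : banach) (u : E -> F) (v : F -> G) :
  bounded_op u -> bounded_op v -> bounded_op (v \o u).
Proof.
move=> /bounded_opP[lu [M M0 hu]] /bounded_opP[lv [N N0 hv]].
apply/bounded_opP; split=> [a x y|]; first by rewrite /= lu lv.
exists (N * M) => [|x]; first exact: mulr_ge0.
by rewrite (le_trans (hv _)) // -mulrA ler_wpM2l.
Qed.

Lemma bounded_op_id (E : banach) : bounded_op (@id E).
Proof.
apply/bounded_opP; split=> //; exists 1 => // x.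
by rewrite mul1r.
Qed.

Lemma bounded_op_lincomb (E F : banach) (a : K) (u v : E -> F) :
  bounded_op u -> bounded_op v -> bounded_op (fun x => a *: u x + v x).
Proof.
move=> /bounded_opP[lu [M M0 hu]] /bounded_opP[lv [N N0 hv]].
apply/bounded_opP; split=> [b x y|].
  by rewrite lu lv !scalerDr !scalerA [b * a]mulrC addrACA.
exists (modulus a * M + N) => [|x].
  by rewrite addr_ge0 // mulr_ge0 // modulus_ge0.
rewrite (le_trans (rnormD _ _)) // mulrDl lerD // rnormZ -mulrA.
by rewrite ler_wpM2l // modulus_ge0.
Qed.

End BoundedOperators.

(** * The Hahn-Banach theorem and bounded functionals *)

Section HahnBanach.
Variables (R : realType) (c : scalar_kind) (V : lmodType (scalars R c)).
Variables (p : seminorm V) (e : V).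
Local Notation K := (scalars R c).

(* Partial real-linear functionals, as graphs; real linearity makes a graph
   dominated by p functional. *)
Let good (G : set (V * R)) :=
  [/\ forall x a y b t, G (x, a) -> G (y, b) -> G (ofR t *: x + y, t * a + b),
      forall x a, G (x, a) -> a <= p x
    & forall z, G z -> G (e, p e)].

Let pZ t x : p (ofR t *: x) = `|t| * p x.
Proof.
rewrite seminormZ; congr (_ * _); apply: (@ofR_inj R c).
rewrite ofR_modulus; have [t0|t0] := leP 0 t.
  by rewrite (ger0_norm t0) ger0_norm // -(ofR0 R c) ler_ofR.
have tN : ofR t = - ofR (- t) :> K.
  by apply/eqP; rewrite -addr_eq0 -ofRD subrr ofR0.
by rewrite tN normrN (ltr0_norm t0) ger0_norm // -(ofR0 R c) ler_ofR oppr_ge0 ltW.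
Qed.

(** The empty chain counts too, and its union is empty; this is why the last clause of [good] asks
    for the point (e, p e) only in nonempty graphs. *)
Let good_bigcup (F : set (set (V * R))) : F `<=` good -> total_on F subset ->
  good (\bigcup_(X in F) X).
Proof.
move=> Fg Ft; split.
- move=> x a y b t [X FX Xx] [Y FY Yy].
  have [XY|YX] := Ft _ _ FX FY.
    by exists Y => //; have [h _ _] := Fg _ FY; apply: h => //; exact: XY.
  by exists X => //; have [h _ _] := Fg _ FX; apply: h => //; exact: YX.
- by move=> x a [X FX Xx]; have [_ h _] := Fg _ FX; exact: h.
by move=> z [X FX Xz]; exists X => //; have [_ _ h] := Fg _ FX; exact: h Xz.
Qed.

Let line_good : good [set z | exists t : R, z = (ofR t *: e, t * p e)].
Proof.
split.
- move=> x a y b t [r [-> ->]] [s [-> ->]]; exists (t * r + s).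
  by rewrite ofRD ofRM scalerDl scalerA mulrDl mulrA.
- move=> x a [t [-> ->]]; rewrite pZ ler_wpM2r ?seminorm_ge0 //.
  exact: ler_norm.
by move=> _ _; exists 1; rewrite ofR1 scale1r mul1r.
Qed.

Lemma real_hahn_banach : exists f : V -> R,
  [/\ forall x y, f (x + y) = f x + f y,
      forall t x, f (ofR t *: x) = t * f x,
      forall x, f x <= p x
    & f e = p e].
Proof.
have [G [[Glin Gp Ge] Gmax]] := Zorn_bigcup good_bigcup.
(* Without this point the maximal graph would be empty, and the line through [e] would properly
   extend it. *)
have {}Ge : G (e, p e).
  apply: contrapT => Ge'; apply: (Gmax [set z | exists t : R, z = (ofR t *: e, t * p e)]) line_good.
  split; first by move=> z /Ge.
    by move=> h; apply: Ge'; apply: h; exists 1; rewrite ofR1 scale1r mul1r.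
have ofRN1 : ofR (-1) = -1 :> K.
  by apply/eqP; rewrite -addr_eq0 -(ofR1 R c) -ofRD addNr ofR0.
have G0 : G (0, 0).
  have := Glin _ _ _ _ (-1) Ge Ge.
  by rewrite ofRN1 scaleN1r mulN1r !addNr.
have Gscale t x a : G (x, a) -> G (ofR t *: x, t * a).
  by move=> Gx; have := Glin _ _ _ _ t Gx G0; rewrite !addr0.
have Gadd x a y b : G (x, a) -> G (y, b) -> G (x + y, a + b).
  by move=> Gx Gy; have := Glin _ _ _ _ 1 Gx Gy; rewrite ofR1 scale1r mul1r.
have Gopp x a : G (x, a) -> G (- x, - a).
  by move=> /(Gscale (-1)); rewrite ofRN1 scaleN1r mulN1r.
have Gfun x a b : G (x, a) -> G (x, b) -> a = b.
  have le a' b' : G (x, a') -> G (x, b') -> a' <= b'.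
    move=> h h'; have /Gp := Gadd _ _ _ _ h (Gopp _ _ h').
    by rewrite subrr seminorm0 subr_le0.
  by move=> h h'; apply: le_anti; rewrite !le.
have Gtot x0 : exists a, G (x0, a).
  apply: contrapT => x0G.
  (* A value [al] at [x0] respects the domination by [p] iff a - p (x - x0) <= al <= p (y + x0) - b
     for all (x, a) and (y, b) in [G]. The supremum of the left-hand sides is chosen. *)
  pose S := [set s | exists x a, G (x, a) /\ s = a - p (x - x0)].
  have Sub y b : G (y, b) -> ubound S (p (y + x0) - b).
    move=> Gy _ [x [a [Gx ->]]]; rewrite lerBlDr -addrA [- b + _]addrC addrA lerBrDr.
    have := Gp _ _ (Gadd _ _ _ _ Gx Gy).
    move=> /le_trans; apply; rewrite -(subrK x0 x) -addrA [x0 + y]addrC.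
    rewrite [p (y + x0) + _]addrC subrK.
    exact: seminormD.
  have Sne : S !=set0 by exists (0 - p (0 - x0)), 0, 0.
  pose al := sup S.
  have al_ge x a : G (x, a) -> a - p (x - x0) <= al.
    move=> Gx; apply: ub_le_sup; last by exists x, a.
    by exists (p (0 + x0) - 0); exact: Sub.
  have al_le y b : G (y, b) -> al <= p (y + x0) - b.
    by move=> Gy; apply: ge_sup => //; exact: Sub.
  pose G' := [set z | exists x a t, G (x, a) /\ z = (x + ofR t *: x0, a + t * al)].
  apply: (Gmax G'); last split.
  - split; first by
      move=> [x a] Gx; exists x, a, 0; rewrite ofR0 scale0r mul0r !addr0.
    move=> G'G; apply: x0G; exists al; apply: G'G.
    by exists 0, 0, 1; rewrite ofR1 scale1r mul1r !add0r.
  - move=> _ _ _ _ t [x [a [r [Gx [-> ->]]]]] [y [b [s [Gy [-> ->]]]]].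
    exists (ofR t *: x + y), (t * a + b), (t * r + s); split; first exact: Glin.
    rewrite ofRD ofRM scalerDl -scalerA mulrDl -mulrA !scalerDr !mulrDr.
    by congr (_, _); rewrite addrACA.
  - move=> _ _ [x [a [t [Gx [-> ->]]]]].
    (* Scaling by 1 / |t| reduces the domination to the upper bound on [al] for t > 0 and to the
       lower bound for t < 0. *)
    have [t0|t0|->] := ltgtP t 0; last first.
    + by rewrite ofR0 scale0r mul0r !addr0; exact: Gp.
    + have t1 : 0 < t^-1 by rewrite invr_gt0.
      have := al_le _ _ (Gscale t^-1 _ _ Gx).
      rewrite -(ler_pM2l t0) mulrBr mulrA mulfV ?gt_eqF // mul1r lerBrDr addrC.
      rewrite -{2}(gtr0_norm t0) -pZ scalerDr scalerA -ofRM.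
      by rewrite mulfV ?gt_eqF // ofR1 scale1r.
    have tN : 0 < - t by rewrite oppr_gt0.
    have := al_ge _ _ (Gscale (- t)^-1 _ _ Gx).
    rewrite -(ler_pM2l tN) mulrBr mulrA mulfV ?gt_eqF // mul1r.
    rewrite -{1}(gtr0_norm tN) -pZ scalerBr scalerA -ofRM.
    rewrite mulfV ?gt_eqF // ofR1 scale1r -scaleN1r scalerA -ofRN1 -ofRM.
    by rewrite mulN1r opprK mulNr lerBlDr => h; rewrite -lerBrDr addrC.
  - move=> z _; exists e, (p e), 0; split => //.
    by rewrite ofR0 scale0r mul0r !addr0.
have /choice[f hf] := Gtot.
exists f; split.
- by move=> x y; apply: (Gfun (x + y)) => //; exact: Gadd.
- by move=> t x; apply: (Gfun (ofR t *: x)) => //; exact: Gscale.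
- by move=> x; exact: Gp.
exact: (Gfun e).
Qed.

End HahnBanach.

Section BoundedFunctional.
Variable R : realType.

Lemma modulusD (c : scalar_kind) (a b : scalars R c) :
  modulus (a + b) <= modulus a + modulus b.
Proof. by rewrite -(ler_ofR c) ofRD !ofR_modulus ler_normD. Qed.

Lemma modulus_ofR_norm (c : scalar_kind) (t : R) :
  modulus (ofR t : scalars R c) = `|t|.
Proof.
have [t0|t0] := leP 0 t; first by rewrite modulus_ofR // ger0_norm.
have -> : ofR t = -1 * ofR (- t) :> scalars R c.
  by apply/eqP; rewrite mulN1r -addr_eq0 -ofRD subrr ofR0.
by rewrite modulusM modulusN1 mul1r (ltr0_norm t0) modulus_ofR // oppr_ge0 ltW.
Qed.

(** A real-linear f dominated by the norm with f e = ||e|| is used as it is over the reals and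
    completed to f x - i f (i x) over the complex numbers. Dividing by the nonzero value at [e]
    normalises it. *)
Lemma exists_bounded_functional (c : scalar_kind)
    (E : completeNormedModType (scalars R c)) (e : E) : e != 0 ->
  exists phi : E -> scalars R c,
  [/\ forall a x y, phi (a *: x + y) = a * phi x + phi y,
      exists2 M, 0 <= M & forall x, modulus (phi x) <= M * rnorm x
    & phi e = 1].
Proof.
suff [phi [lphi [M M0 hM] phie]] : exists phi : E -> scalars R c,
    [/\ forall a x y, phi (a *: x + y) = a * phi x + phi y,
        exists2 M, 0 <= M & forall x, modulus (phi x) <= M * rnorm x
      & e != 0 -> phi e != 0].
  move=> e0; exists (fun x => (phi e)^-1 * phi x); split.
  - by move=> a x y; rewrite lphi mulrDr mulrCA.
  - exists (modulus (phi e)^-1 * M); first by rewrite mulr_ge0 // modulus_ge0.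
    by move=> x; rewrite modulusM -mulrA ler_wpM2l // modulus_ge0.
  by rewrite mulVf // phie.
case: c E e => E e; have [f [fD fZ fp fe]] := real_hahn_banach (rnorm_seminorm E) e.
  have fN x : f (- x) = - f x.
    by have := fZ (-1) x; rewrite [_ *: x]scaleN1r mulN1r.
  exists f; split=> [a x y||].
  - by rewrite fD fZ.
  - exists 1 => // x; rewrite mul1r [modulus _]/= ler_norml fp andbT lerNl.
    by rewrite -fN (le_trans (fp _)) // [X in X <= _]rnormN.
  by rewrite fe; apply: contraNN => /eqP /rnorm_eq0 ->.
pose i : scalars R ComplexScalars := ('i)%C.
have ii : i * i = -1 by rewrite -expr2 [LHS]sqr_i.
have dec a : exists s t, a = ofR s + ofR t * i :> scalars R ComplexScalars.
  exists (complex.Re a), (complex.Im a).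
  by rewrite [LHS]complexE mulrC.
have fNi x : f (i *: (i *: x)) = - f x.
  rewrite scalerA ii (_ : -1 = ofR (-1)) ?fZ ?mulN1r //.
  by rewrite /ofR rmorphN1.
pose phi x : scalars R ComplexScalars := ofR (f x) - i * ofR (f (i *: x)).
exists phi; split=> [a x y||].
- have phiD u v : phi (u + v) = phi u + phi v.
    by rewrite /phi scalerDr !fD !ofRD; ring.
  rewrite phiD; congr (_ + _); have [s [t ->]] := dec a.
  rewrite scalerDl phiD -scalerA mulrDl /phi !fZ.
  rewrite ![i *: (ofR _ *: _)]scalerA ![i * ofR _]mulrC -!scalerA !fZ fNi.
  rewrite !ofRM (_ : ofR (- f x) = - ofR (f x)); last by rewrite /ofR rmorphN.
  ring: ii.
- have i0 : 0 <= 1 + modulus i * modulus i.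
    by rewrite addr_ge0 // mulr_ge0 // modulus_ge0.
  exists (1 + modulus i * modulus i) => // x.
  have fle u : `|f u| <= rnorm u.
    rewrite ler_norml [X in _ && X]fp andbT lerNl.
    have <- : f (- u) = - f u.
      by have := fZ (-1) u; rewrite /ofR rmorphN1 scaleN1r mulN1r.
    by rewrite (le_trans (fp _)) // [X in X <= _]rnormN.
  rewrite (le_trans (modulusD _ _)) // mulrDl mul1r -mulN1r !modulusM modulusN1.
  rewrite mul1r !modulus_ofR_norm lerD // -mulrA ler_wpM2l ?modulus_ge0 //.
  by rewrite -rnormZ.
apply: contraNN => /eqP h.
have {}h : ofR (f e) = i * ofR (f (i *: e)) by apply/eqP; rewrite -subr_eq0 -/(phi e) h.
(* Squaring f e = i f (i e) gives an equation between real numbers, which forces f e = ||e|| = 0. *)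
have sq : f e * f e + f (i *: e) * f (i *: e) = 0.
  apply: (@ofR_inj R ComplexScalars).
  by rewrite ofRD !ofRM ofR0 {1 2}h; ring: ii.
apply/eqP/rnorm_eq0; rewrite -[LHS]fe.
have : f e * f e == 0.
  by apply/eqP; nra.
by rewrite mulf_eq0 orbb => /eqP.
Qed.

End BoundedFunctional.

(** * Continuity and boundedness of multilinear mappings *)

Section ProductNeighborhoods.
Variables (R : realType) (c : scalar_kind).
Local Notation K := (scalars R c).
Local Notation banach := (completeNormedModType K).
Variables (n : nat) (E : 'I_n -> banach).

(** The boxes generate a filter that converges to [x] in each coordinate, hence in the product
    topology, the supremum of the coordinate ones. Conversely, the index set being finite, a box is
    a finite intersection of coordinate neighbourhoods. *)
Lemma nbhs_prod_rnormP (x : prod_topology (fun i => E i)) (A : set (prod_topology (fun i => E i))) :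
  nbhs x A <-> exists2 d : R, 0 < d &
    forall y : forall i, E i, (forall i, rnorm (x i - y i) < d) -> A y.
Proof.
split=> [xA|[d d0 hd]].
  pose F : set_system (prod_topology (fun i => E i)) := [set B | exists2 d : R, 0 < d &
    forall y : forall i, E i, (forall i, rnorm (x i - y i) < d) -> B y].
  have FF : Filter F.
    split; first by exists 1.
      move=> B B' [d d0 hd] [d' d'0 hd']; exists (Num.min d d').
        by rewrite lt_min d0.
      by move=> y hy; split; [apply: hd|apply: hd'] => i;
        have := hy i; rewrite lt_min => /andP[].
    by move=> B B' BB' [d d0 hd]; exists d => // y hy; apply/BB'/hd.
  suff h : F --> (x : prod_topology (fun i => E i)) by exact: h.
  apply/cvg_sup => i B /= [_ [[U oU <-] /= Ux UB]].
  have : nbhs (x i) U by exact: open_nbhs_nbhs.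
  move=> /nbhs_normP[_ /= /gt0_ofR[d d0 <-] hd].
  exists d => // y hy; apply: UB => /=; apply: hd.
  by rewrite /ball_ /= rnormE ltr_ofR.
have h i : nbhs x [set y | rnorm (x i - y i) < d].
  have dK : 0 < ofR d :> K by rewrite -(ofR0 R c) ltr_ofR.
  have := @proj_continuous _ (fun i => E i) i x.
  move=> /(@cvgrPdist_lt _ _ _ _ (nbhs_filter x)) /(_ _ dK) hi.
  apply: (@filterS _ _ (nbhs_filter x) _ _ _ hi) => y.
  by rewrite rnormE ltr_ofR.
have hx := @filter_forall _ _ _ _ (nbhs_filter x) h.
by apply: (@filterS _ _ (nbhs_filter x) _ _ _ hx) => y; exact: hd.
Qed.

End ProductNeighborhoods.

Section Multilinear.
Variables (R : realType) (c : scalar_kind) (n : nat).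
Local Notation K := (scalars R c).

Section Algebraic.
Variables (E : 'I_n -> lmodType K) (F : lmodType K) (B : (forall i, E i) -> F).
Hypothesis mB : multilinear B.

Lemma dfwith_id (x : forall i, E i) i : dfwith x i (x i) = x.
Proof. by apply: functional_extensionality_dep => j; case: dfwithP. Qed.

Lemma multilinear0 (x : forall i, E i) j : x j = 0 -> B x = 0.
Proof. by have h := @mB x j; move=> xj; rewrite -(dfwith_id x j) xj (linear_fun0 h). Qed.

Lemma multilinear_dfwithZ (x : forall i, E i) j a y :
  B (dfwith x j (a *: y)) = a *: B (dfwith x j y).
Proof. by have h := @mB x j; exact: (linear_funZ h). Qed.

Lemma multilinear_dfwithB (x : forall i, E i) j y z :
  B (dfwith x j (y - z)) = B (dfwith x j y) - B (dfwith x j z).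
Proof. by have h := @mB x j; exact: (linear_funB h). Qed.

(** Interpolates between [y] (empty list) and [x] (full enumeration), so that induction on the list
    changes one coordinate at a time. *)
Definition hybrid (s : seq 'I_n) (x y : forall i, E i) : forall i, E i :=
  fun i => if i \in s then x i else y i.

Lemma hybrid_nil x y : hybrid [::] x y = y.
Proof. by []. Qed.

Lemma hybrid_enum x y : hybrid (index_enum 'I_n) x y = x.
Proof. by apply: functional_extensionality_dep => i; rewrite /hybrid mem_index_enum. Qed.

Lemma hybrid_cons j s x y : hybrid (j :: s) x y = dfwith (hybrid s x y) j (x j).
Proof.
apply: functional_extensionality_dep => i; rewrite /hybrid inE.
have [->|ij] := eqVneq i j; first by rewrite dfwithin.
by rewrite dfwithout // eq_sym.
Qed.

Lemma hybrid_dfwith j s x y : j \notin s ->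
  hybrid s x y = dfwith (hybrid s x y) j (y j).
Proof.
move=> js; have -> : y j = hybrid s x y j by rewrite /hybrid (negPf js).
by rewrite dfwith_id.
Qed.

Lemma multilinear_scale (a : 'I_n -> K) x :
  B (fun i => a i *: x i) = (\prod_(i < n) a i) *: B x.
Proof.
rewrite -(hybrid_enum (fun i => a i *: x i) x).
elim: index_enum (index_enum_uniq 'I_n) => [_|j s IH /= /andP[js us]].
  by rewrite hybrid_nil big_nil scale1r.
rewrite hybrid_cons multilinear_dfwithZ -(hybrid_dfwith _ x js) IH //.
by rewrite big_cons scalerA.
Qed.

End Algebraic.

Local Notation banach := (completeNormedModType K).
Variables (E : 'I_n -> banach) (F : banach).

Definition multibounded (B : (forall i, E i) -> F) :=
  exists2 M, 0 <= M & forall x, rnorm (B x) <= M * \prod_(i < n) rnorm (x i).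

(** Telescoping over [hybrid]: changing one coordinate costs at most M d r^(n-1), so that L = n M
    r^(n-1). *)
Lemma multilinear_lipschitz (B : (forall i, E i) -> F) (r : R) :
  multilinear B -> multibounded B -> 0 <= r ->
  exists2 L, 0 <= L & forall x y d, 0 <= d ->
    (forall i, rnorm (x i) <= r) -> (forall i, rnorm (y i) <= r) ->
    (forall i, rnorm (x i - y i) <= d) -> rnorm (B x - B y) <= L * d.
Proof.
move=> mB [M M0 hM] r0.
pose L (s : seq 'I_n) := \sum_(j <- s) M * \prod_(i < n | i != j) r.
exists (L (index_enum 'I_n)) => [|x y d d0 hx hy hd].
  by apply: sumr_ge0 => j _; rewrite mulr_ge0 // prodr_ge0.
rewrite -{1}(hybrid_enum x y).
elim: index_enum (index_enum_uniq 'I_n) => [_|j s IH /= /andP[js us]].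
  by rewrite hybrid_nil subrr rnorm0 /L big_nil mul0r.
rewrite (le_trans (rnorm_distD (B (hybrid s x y)) _ _)) // /L big_cons mulrDl.
rewrite lerD ?IH // hybrid_cons {2}(hybrid_dfwith x y js).
rewrite -(multilinear_dfwithB mB) (le_trans (hM _)) // -mulrA ler_wpM2l //.
rewrite (bigD1 j) //= dfwithin mulrC ler_pM ?rnorm_ge0 //.
  by apply: prodr_ge0 => i _; exact: rnorm_ge0.
apply: ler_prod => i ij; rewrite rnorm_ge0 dfwithout 1?eq_sym //= /hybrid.
by case: ifP => _; [exact: hx | exact: hy].
Qed.

(** Homogeneity in each variable: nonzero coordinates are scaled to norm d / 2, and a zero
    coordinate makes [B] vanish. *)
Lemma multibounded_ball (B : (forall i, E i) -> F) (d M : R) :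
  multilinear B -> 0 < d ->
  (forall x, (forall i, rnorm (x i) < d) -> rnorm (B x) <= M) -> multibounded B.
Proof.
move=> mB d0 hM; have d2 : 0 < d / 2 by rewrite divr_gt0.
have M0 : 0 <= M.
  by apply: le_trans (rnorm_ge0 _) (hM (fun=> 0) _) => i; rewrite rnorm0.
exists ((d / 2) ^- n * M) => [|x].
  by rewrite mulr_ge0 // invr_ge0 exprn_ge0 // ltW.
have [/existsP[j /eqP xj]|/existsPn x0] := boolP [exists j, rnorm (x j) == 0].
  rewrite (multilinear0 mB (rnorm_eq0 xj)) rnorm0 !mulr_ge0 //.
    by rewrite invr_ge0 exprn_ge0 // ltW.
  by apply: prodr_ge0 => i _; exact: rnorm_ge0.
have {}x0 i : 0 < rnorm (x i) by rewrite lt_neqAle eq_sym x0 rnorm_ge0.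
have t0 i : 0 < d / 2 / rnorm (x i) by rewrite divr_gt0.
have P0 : 0 < \prod_(i < n) (d / 2 / rnorm (x i)) by exact: prodr_gt0.
have bound : (\prod_(i < n) (d / 2 / rnorm (x i))) * rnorm (B x) <= M.
  have -> : \prod_(i < n) (d / 2 / rnorm (x i)) =
      modulus (\prod_(i < n) ofR (d / 2 / rnorm (x i)) : K).
    rewrite -(modulus_ofR c (ltW P0)); congr modulus.
    exact: (big_morph ofR (@ofRM R c) (ofR1 R c)).
  rewrite -rnormZ -(multilinear_scale mB); apply: hM => i.
  rewrite rnormZ modulus_ofR ?(ltW (t0 i)) //.
  by rewrite divfK ?gt_eqF //; lra.
have P1 : \prod_(i < n) (d / 2 / rnorm (x i)) *
    ((d / 2) ^- n * \prod_(i < n) rnorm (x i)) = 1.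
  rewrite big_split /= prodfV prodr_const card_ord mulrACA mulfV ?mulVf ?mulr1 //.
    by rewrite gt_eqF // prodr_gt0.
  by rewrite expf_neq0 // gt_eqF.
rewrite -(ler_pM2l P0) (le_trans bound) //.
by rewrite -[X in _ * X]mulrA [M * _]mulrC [X in _ * X]mulrA mulrA P1 mul1r.
Qed.

Lemma cont_multilinearP (B : (forall i, E i) -> F) :
  cont_multilinear B <-> multilinear B /\ multibounded B.
Proof.
split=> -[mB h]; split=> //.
  have K0 : 0 < ofR 1 :> K by rewrite ofR1.
  have /cvgrPdist_lt /(_ _ K0) /nbhs_prod_rnormP[d d0 hd] :=
    h ((fun=> 0) : prod_topology (fun i => E i)).
  (* For n = 0 multilinearity does not force the value at 0 to vanish, so that value enters the
     bound. *)
  apply: (multibounded_ball (M := 1 + rnorm (B (fun=> 0))) mB d0) => x xd.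
  have /hd : forall i, rnorm (0 - x i) < d by move=> i; rewrite sub0r rnormN.
  rewrite /= rnormE ltr_ofR => hx.
  rewrite -[X in rnorm X](subrK (B (fun=> 0))).
  by rewrite (le_trans (rnormD _ _)) // lerD2r rnorm_distC ltW.
move=> x; have r0 : 0 <= \sum_(i < n) rnorm (x i) + 1.
  by rewrite addr_ge0 // sumr_ge0 // => i _; exact: rnorm_ge0.
have [L L0 hL] := multilinear_lipschitz mB h r0.
apply/(@cvgrPdist_lt _ _ _ _ (@nbhs_filter (prod_topology (fun i => E i)) x)).
move=> _ /= /gt0_ofR[e e0 <-]; apply/nbhs_prod_rnormP.
have L1 : 0 < L + 1 by rewrite ltr_wpDl.
(* The bound 1 keeps [y] in the ball on which [L] is a Lipschitz constant, whose radius is 1 plus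
   the sum of the norms of the x_i. *)
exists (Num.min 1 (e / (L + 1))) => [|y hy]; first by rewrite lt_min divr_gt0 ?ltr01.
have xr i : rnorm (x i) <= \sum_(i < n) rnorm (x i).
  by rewrite (bigD1 i) //= lerDl sumr_ge0 // => j _; exact: rnorm_ge0.
have hxy i : rnorm (x i - y i) <= e / (L + 1).
  by have := hy i; rewrite lt_min => /andP[_ /ltW].
rewrite rnormE ltr_ofR.
rewrite (le_lt_trans (hL x y (e / (L + 1)) _ _ _ hxy)) //.
- by rewrite divr_ge0 // ltW.
- by move=> i; rewrite (le_trans (xr i)) // lerDl.
- move=> i; rewrite -(subrK (x i) (y i)) (le_trans (rnormD _ _)) // addrC lerD //.
  by have := hy i; rewrite rnorm_distC lt_min => /andP[/ltW].
by rewrite mulrA ltr_pdivrMr // mulrC ltr_pM2l // ltrDl.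
Qed.

End Multilinear.

(** * Universal properties of the projective tensor powers *)

Section SpanLift.
Variables (R : realType) (c : scalar_kind).
Local Notation K := (scalars R c).
Local Notation banach := (completeNormedModType K).
Variables (W : lmodType K) (X : Type) (g : X -> W) (w : X -> R).
Hypothesis w_ge0 : forall x, 0 <= w x.
Local Notation comp := (completion (span_seminorm g w_ge0)).
Local Notation gen x := (to_completion (span_seminorm g w_ge0) (span_gen g x)).

Lemma span_completion_op_eq (F : banach) (u v : comp -> F) :
  bounded_op u -> bounded_op v -> (forall x, u (gen x) = v (gen x)) -> u =1 v.
Proof.
move=> bu bv uv; apply: completion_op_eq => // x.
have [s xs] : exists s, x = \sum_(a <- s) a.1 *: span_gen g a.2.
  have /asboolP[s hs] := lspan_valP x; exists s; apply: val_inj.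
  by rewrite [LHS]hs raddf_sum; apply: eq_bigr => a _.
have [/bounded_opP[lu _] /bounded_opP[lv _]] := (bu, bv).
rewrite xs linear_sum (linear_fun_sum lu) (linear_fun_sum lv).
by apply: eq_bigr => a _; rewrite linearZ (linear_funZ lu) (linear_funZ lv) uv.
Qed.

(** Since [h] respects the linear relations among the generators, it extends to their span;
    representations of nearly minimal cost give the norm bound. With [g] and [w] left general, this
    serves the full and the symmetric power alike. *)
Lemma span_completion_lift (F : banach) (h : X -> F) (M : R) :
  0 <= M -> (forall x, rnorm (h x) <= M * w x) ->
  (forall s, lincomb g s = 0 -> \sum_(a <- s) a.1 *: h a.2 = 0) ->
  exists2 u : comp -> F, bounded_op u & forall x, u (gen x) = h x.
Proof.
move=> M0 hM h0.
have hE s t : lincomb g s = lincomb g t ->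
    \sum_(a <- s) a.1 *: h a.2 = \sum_(a <- t) a.1 *: h a.2.
  move=> st; apply/eqP; rewrite -subr_eq0; apply/eqP.
  (* Two representations of one vector, the second negated, form a single relation. *)
  pose t' := [seq (- a.1, a.2) | a <- t].
  have tN (G : lmodType K) (k : X -> G) :
      \sum_(a <- s ++ t') a.1 *: k a.2 =
      \sum_(a <- s) a.1 *: k a.2 - \sum_(a <- t) a.1 *: k a.2.
    rewrite big_cat big_map -sumrN; congr (_ + _).
    by apply: eq_bigr => a _; rewrite scaleNr.
  by rewrite -tN; apply: h0; rewrite /lincomb tN [X in X - _]st subrr.
have /choice[f hf] (v : lspan g) : exists y, forall s, lspan_val v = lincomb g s ->
    y = \sum_(a <- s) a.1 *: h a.2.
  have /asboolP[s vs] := lspan_valP v.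
  by exists (\sum_(a <- s) a.1 *: h a.2) => t vt; apply: hE; rewrite -vs.
have lf : linear f.
  move=> a u v; have /asboolP[s us] := lspan_valP u.
  have /asboolP[t vt] := lspan_valP v.
  rewrite (hf _ _ us) (hf _ _ vt) (hf _ ([seq (a * b.1, b.2) | b <- s] ++ t)).
    rewrite big_cat big_map scaler_sumr; congr (_ + _).
    by apply: eq_bigr => b _; rewrite scalerA.
  rewrite /lincomb big_cat big_map /= us vt /lincomb scaler_sumr; congr (_ + _).
  by apply: eq_bigr => b _; rewrite scalerA.
have [v|u [lu hu ug]] := @completion_extension _ _ _ (span_seminorm g w_ge0) F f M lf M0.
  apply/ler_addgt0Pr => e e0.
  have M1 : 0 < M + 1 by rewrite ltr_wpDl.
  have [s vs cs] := span_norm_lt w_ge0 v (divr_gt0 e0 M1).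
  rewrite (hf _ _ vs) (le_trans (rnorm_sum _ _ _)) //.
  have hc : \sum_(a <- s) rnorm (a.1 *: h a.2) <= M * cost w s.
    rewrite /cost mulr_sumr ler_sum // => a _; rewrite rnormZ mulrCA.
    by rewrite ler_wpM2l // modulus_ge0.
  rewrite (le_trans hc) // (le_trans (ler_wpM2l M0 (ltW cs))) // mulrDr lerD2l.
  by rewrite mulrA ler_pdivrMr // mulrC ler_wpM2l ?ltW // ltrDl.
exists u; first by apply/bounded_opP; split=> //; exists M.
move=> x; rewrite ug (hf _ [:: (1, x)]); first by rewrite big_seq1 scale1r.
by rewrite /lincomb big_seq1 scale1r.
Qed.

End SpanLift.

Section TensorLift.
Variables (R : realType) (c : scalar_kind) (n : nat).
Local Notation K := (scalars R c).
Local Notation banach := (completeNormedModType K).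

(** [atens] sees only scalar forms. If the sum in [F] were nonzero, a functional with value 1 on it,
    composed with [B], would be a scalar form violating the relation. *)
Lemma atens_relation (E : 'I_n -> banach) (F : banach)
    (B : (forall i, E i) -> F) (s : seq (K * (forall i, E i))) :
  multilinear B -> \sum_(a <- s) a.1 *: atens a.2 = 0 ->
  \sum_(a <- s) a.1 *: B a.2 = 0.
Proof.
move=> mB s0; apply/eqP/negPn/negP => /exists_bounded_functional[phi [lphi _ phi1]].
have lphi' : linear (phi : F -> K^o) by [].
have mphi : multilinear (fun x => phi (B x) : K^o).
  by move=> x i a y z; rewrite /= (@mB x i) lphi.
have := congr1 (fun f => f (exist _ _ mphi)) s0.
rewrite fct_sumE /= => h; have /eqP := oner_neq0 K; apply.
rewrite -phi1 [LHS](linear_fun_sum lphi') -[RHS]h.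
by apply: eq_bigr => a _; rewrite (linear_funZ lphi').
Qed.

Section Projective.
Variables (E : 'I_n -> banach).

Lemma ptens_multibounded : multibounded (@ptens R c n E).
Proof.
exists 1 => // x; rewrite mul1r -(ler_ofR c) -rnormE.
rewrite (le_trans (ptens_norm_le x)) //.
rewrite (big_morph ofR (@ofRM R c) (ofR1 R c)) le_eqVlt; apply/orP; left.
by apply/eqP; apply: eq_bigr => i _; rewrite rnormE.
Qed.

Lemma ptens_cont_multilinear : cont_multilinear (@ptens R c n E).
Proof.
by apply/cont_multilinearP; split; [exact: ptens_multilinear|exact: ptens_multibounded].
Qed.

Lemma ptensor_op_eq (F : banach) (u v : ptensor E -> F) :
  bounded_op u -> bounded_op v -> (forall x, u (ptens x) = v (ptens x)) -> u =1 v.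
Proof. exact: span_completion_op_eq. Qed.

Lemma ptensor_lift (F : banach) (B : (forall i, E i) -> F) :
  multilinear B -> multibounded B ->
  exists2 u : ptensor E -> F, bounded_op u & forall x, u (ptens x) = B x.
Proof.
move=> mB [M M0 hM].
apply: (@span_completion_lift _ _ _ _ _ _ (@pi_weight_ge0 _ _ _ E) F B M) => // s s0.
exact: atens_relation.
Qed.

End Projective.

Variable E : banach.

Lemma stensor_op_eq (F : banach) (u v : stensor n E -> F) :
  bounded_op u -> bounded_op v -> (forall x, u (stens n x) = v (stens n x)) -> u =1 v.
Proof. exact: span_completion_op_eq. Qed.

Lemma stensor_lift (F : banach) (B : ('I_n -> E) -> F) :
  multilinear (E := fun=> E) B -> multibounded (E := fun=> E) B ->
  exists2 u : stensor n E -> F, bounded_op u & forall x, u (stens n x) = B (fun=> x).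
Proof.
move=> mB [M M0 hM].
apply: (@span_completion_lift _ _ _ _ _ _ (@pi_s_weight_ge0 _ _ n E) F
  (fun x => B (fun=> x)) M) => // [x|s s0].
  by rewrite (le_trans (hM _)) // prodr_const card_ord.
(* A relation among powers of single vectors is a relation among full tensors at constant
   families. *)
have := @atens_relation (fun=> E) F B [seq (a.1, fun=> a.2) | a <- s] mB.
by rewrite !big_map; apply.
Qed.

End TensorLift.

(** * The polarization formula *)

Section Polarization.
Variables (R : realType) (c : scalar_kind) (n : nat).
Local Notation K := (scalars R c).
Local Notation banach := (completeNormedModType K).

Section Expansion.
Variables (E F : lmodType K) (B : ('I_n -> E) -> F).
Hypothesis mB : multilinear (E := fun=> E) B.

(** Induction on the list of expanded slots. A choice of indices on [s] is encoded as a total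
    function with the default value [i0] off [s], so that each choice is counted once. *)
Lemma multilinear_expand (I : finType) (i0 : I) (y : 'I_n -> I -> E) :
  B (fun j => \sum_i y j i) =
  \sum_(f : {ffun 'I_n -> I}) B (fun j => y j (f j)).
Proof.
pose D (s : seq 'I_n) (f : {ffun 'I_n -> I}) := [forall j, (j \notin s) ==> (f j == i0)].
suff key s : uniq s -> forall z : 'I_n -> E,
    B (fun j => if j \in s then \sum_i y j i else z j) =
    \sum_(f | D s f) B (fun j => if j \in s then y j (f j) else z j).
  have := key _ (index_enum_uniq 'I_n) (fun=> 0).
  under eq_fun do rewrite mem_index_enum.
  move=> ->; apply: eq_big => [f|f _].
    by apply/forallP => j; rewrite mem_index_enum.
  by congr B; apply/funext => j; rewrite mem_index_enum.
elim: s => [_ z|j s IH /= /andP[js us] z].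
  rewrite (big_pred1 [ffun=> i0]) // => f; apply/forallP/eqP => [h|-> k].
    by apply/ffunP => k; rewrite ffunE; apply/eqP; have := h k.
  by rewrite ffunE eqxx implybT.
have -> : (fun k => if k \in j :: s then \sum_i y k i else z k) =
    dfwith (T := fun=> E) (fun k => if k \in s then \sum_i y k i else z k) j (\sum_i y j i).
  apply/funext => k; rewrite inE; have [->|kj] := eqVneq k j.
    by rewrite dfwithin.
  by rewrite dfwithout // eq_sym.
have lB := @mB (fun k => if k \in s then \sum_i y k i else z k) j.
rewrite (linear_fun_sum lB).
have in_s (g : 'I_n -> E) (u : E) :
    dfwith (T := fun=> E) (fun k => if k \in s then g k else z k) j u =
    (fun k => if k \in s then g k else dfwith (T := fun=> E) z j u k).
  apply/funext => k; have [<-|kj] := eqVneq j k.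
    by rewrite (negPf js) !dfwithin.
  by rewrite !dfwithout.
transitivity (\sum_i \sum_(f | D s f)
    B (fun k => if k \in s then y k (f k) else dfwith (T := fun=> E) z j (y j i) k)).
  by apply: eq_bigr => i _; rewrite -IH //; congr B; exact: in_s.
rewrite pair_big_dep /=.
(* Splits off the value at [j] and resets it to [i0]: a bijection from the choices on [j :: s] onto
   the pairs of an index and a choice on [s], with inverse [h']. *)
pose h (f : {ffun 'I_n -> I}) := (f j, [ffun k => if k == j then i0 else f k]).
pose h' (q : I * {ffun 'I_n -> I}) := [ffun k => if k == j then q.1 else q.2 k].
rewrite (reindex_onto h h') /=; last first.
  move=> [i f] /= /forallP fD; congr pair; first by rewrite ffunE eqxx.
  apply/ffunP => k; rewrite !ffunE; have [->|//] := eqVneq k j.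
  by have := fD j; rewrite js => /eqP.
apply: eq_big => [f|f _].
  apply/andP/forallP => [[/forallP fD _] k|fD].
    rewrite inE negb_or; apply/implyP => /andP[kj ks].
    have := fD k; rewrite ks ffunE. by move: kj; case: (k == j).
  split.
    apply/forallP => k; apply/implyP => ks; rewrite ffunE.
    have [//|kj] := eqVneq k j; have := fD k.
    by rewrite inE (negPf kj) ks.
  apply/eqP/ffunP => k; rewrite !ffunE /=.
  have [->//|kj] := eqVneq k j; by rewrite ?ffunE ?(negPf kj).
congr B; apply/funext => k; rewrite inE ffunE.
have [->|kj] := eqVneq k j; first by rewrite (negPf js) dfwithin.
by rewrite dfwithout // eq_sym.
Qed.

Definition subset_sign (a : {ffun 'I_n -> bool}) : K := \prod_i (-1) ^+ (~~ a i).

(** The sum factors over [i]. The two values of [a i] contribute 1 and, only when [i] is not a value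
    of [f], -1. So the factor is 1 on the range of [f] and 0 off it; the product tests surjectivity,
    which for these self-maps is injectivity. *)
Lemma sum_subset_sign (f : {ffun 'I_n -> 'I_n}) :
  \sum_a subset_sign a * \prod_j (a (f j))%:R = (injectiveb f)%:R.
Proof.
have -> : \sum_a subset_sign a * \prod_j (a (f j))%:R =
    \sum_(a : {ffun 'I_n -> bool}) \prod_i
      ((-1) ^+ (~~ a i) * \prod_(j | f j == i) (a i)%:R).
  apply: eq_bigr => a _; rewrite big_split /=; congr (_ * _).
  rewrite (partition_big f predT) //=; apply: eq_bigr => i _.
  by apply: eq_bigr => j /eqP ->.
rewrite -(bigA_distr_bigA (fun i (b : bool) =>
  (-1) ^+ (~~ b) * \prod_(j | f j == i) b%:R)).
have [finj|fNinj] := boolP (injectiveb f).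
  rewrite big1 // => i _; rewrite big_bool /= expr0 expr1 big1 // mulr1.
  have [g fK gK] := injF_bij (injectiveP _ finj).
  by rewrite (bigD1 (g i)) /= ?gK // mul0r mulr0 addr0.
have [i hi] : exists i, forall j, f j != i.
  apply: contrapT => h; move/negP: fNinj; apply.
  apply/injectiveP.
  have cf i : i \in codom f.
    apply/negPn/negP => hi; apply: h; exists i => j.
    by apply: contraNN hi => /eqP <-; exact: codom_f.
  have /image_injP finj : #|[seq f x | x in 'I_n]| == #|'I_n|.
    by apply/eqP/eq_card => i; rewrite [LHS]cf.
  by move=> x y; exact: finj.
have p0 : (fun j => f j == i) =1 xpred0 by move=> j; apply: negbTE (hi j).
rewrite (bigD1 i) //= big_bool /= !(eq_bigl _ _ p0) !big_pred0_eq.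
by rewrite expr0 expr1 !mulr1 subrr mul0r.
Qed.

(** Expanding every slot and summing over the subsets first leaves the permutations, which appear as
    injective finite functions. *)
Lemma polarization (x : 'I_n -> E) : (0 < n)%N ->
  \sum_a subset_sign a *: B (fun=> \sum_i (a i)%:R *: x i) =
  \sum_(f : {ffun 'I_n -> 'I_n} | injectiveb f) B (x \o f).
Proof.
move=> n_gt0.
transitivity (\sum_(f : {ffun 'I_n -> 'I_n})
    (\sum_a subset_sign a * \prod_j (a (f j))%:R) *: B (x \o f)).
  under [RHS]eq_bigr do rewrite scaler_suml.
  rewrite exchange_big /=; apply: eq_bigr => a _.
  rewrite (multilinear_expand (Ordinal n_gt0) (fun _ i => (a i)%:R *: x i)).
  rewrite scaler_sumr; apply: eq_bigr => f _.
  rewrite -scalerA; congr (_ *: _).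
  exact: (multilinear_scale mB (fun j => (a (f j))%:R) (x \o f)).
rewrite [RHS]big_mkcond; apply: eq_bigr => f _.
by rewrite sum_subset_sign; case: ifP; rewrite ?scale1r ?scale0r.
Qed.

End Expansion.

End Polarization.

(** * The symmetric power as a retract of the full power *)

Section Retracts.
Variables (R : realType) (c : scalar_kind).
Local Notation K := (scalars R c).
Local Notation banach := (completeNormedModType K).

Lemma bounded_op_scale (E F : banach) (a : K) (u : E -> F) :
  bounded_op u -> bounded_op (fun x => a *: u x).
Proof.
move=> /bounded_opP[lu [M M0 hu]]; apply/bounded_opP; split=> [b x y|].
  by rewrite lu scalerDr !scalerA mulrC.
exists (modulus a * M) => [|x]; first by rewrite mulr_ge0 ?modulus_ge0.
by rewrite rnormZ -mulrA ler_wpM2l // modulus_ge0.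
Qed.

Definition retract (X Y : banach) := exists i : X -> Y, exists2 p : Y -> X,
  bounded_op i /\ bounded_op p & cancel i p.

Lemma multibounded_rnorm_le1 n (E : 'I_n -> banach) (F : banach)
    (B : (forall i, E i) -> F) : multibounded B ->
  exists2 M, 0 <= M & forall x, (forall i, rnorm (x i) <= 1) -> rnorm (B x) <= M.
Proof.
move=> [M M0 hM]; exists M => // x hx; rewrite (le_trans (hM x)) //.
rewrite ler_piMr // -[leRHS](@big1_eq _ 1 *%R _ (index_enum 'I_n) predT).
by apply: ler_prod => i _; rewrite rnorm_ge0 hx.
Qed.

Lemma dfwith_funE n (T : Type) (x : 'I_n -> T) i y j :
  dfwith (T := fun=> T) x i y j = if i == j then y else x j.
Proof. by have [<-|ij] := eqVneq i j; rewrite ?dfwithin ?dfwithout. Qed.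

Lemma dfwith_comp_inj n m (T : Type) (f : 'I_m -> 'I_n) (x : 'I_n -> T) i y :
  injective f ->
  dfwith (T := fun=> T) x (f i) y \o f = dfwith (T := fun=> T) (x \o f) i y.
Proof.
by move=> finj; apply/funext => j /=; rewrite !dfwith_funE (inj_eq finj).
Qed.

Lemma dfwith_comp_notin n m (T : Type) (f : 'I_m -> 'I_n) (x : 'I_n -> T) i y :
  i \notin codom f -> dfwith (T := fun=> T) x i y \o f = x \o f.
Proof.
move=> hi; apply/funext => j /=; rewrite dfwith_funE.
by case: eqVneq => // ij; rewrite ij codom_f in hi.
Qed.

Section Symmetrization.
Variables (n : nat) (E : banach).
Hypothesis n_gt0 : (0 < n)%N.

(** n! times the symmetrisation of the tensor of the x_i, written by polarization because [stens]
    provides only powers of single vectors. *)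
Definition sym_form (x : 'I_n -> E) : stensor n E :=
  \sum_(a : {ffun 'I_n -> bool}) subset_sign R c a *:
    stens n (\sum_i (a i)%:R *: x i).

Lemma stens_rnorm_le (x : E) : rnorm (stens n x) <= rnorm x ^+ n.
Proof.
rewrite rnorm_to_completion.
have xE : lspan_val (span_gen (@satens R c n E) x) = lincomb (@satens R c n E) [:: (1, x)].
  by rewrite /lincomb big_seq1 scale1r.
rewrite (le_trans (span_norm_le (@pi_s_weight_ge0 R c n E) xE)) //.
by rewrite /cost big_seq1 modulus1 mul1r.
Qed.

Let sym_span (x : 'I_n -> E) : lspan (@satens R c n E) :=
  \sum_(a : {ffun 'I_n -> bool}) subset_sign R c a *:
    span_gen (@satens R c n E) (\sum_i (a i)%:R *: x i).

Let sym_formE x : sym_form x = to_completion (sproj_seminorm n E) (sym_span x).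
Proof. by rewrite linear_sum; apply: eq_bigr => a _; rewrite linearZ. Qed.

(** Before completion a symmetric tensor is a functional on forms, so identities can be checked on
    each form [C]. There the signed sum is a sum over permutations, from which multilinearity and
    the diagonal values are read off. *)
Let sym_spanE x C : lspan_val (sym_span x) C =
  \sum_(f : {ffun 'I_n -> 'I_n} | injectiveb f) sval C (x \o f).
Proof.
have -> : lspan_val (sym_span x) = \sum_(a : {ffun 'I_n -> bool})
    subset_sign R c a *: satens (\sum_i (a i)%:R *: x i).
  by rewrite -[LHS]/(\val (sym_span x)) raddf_sum; apply: eq_bigr.
by rewrite -(polarization (svalP C)) // fct_sumE.
Qed.

Lemma sym_form_multilinear : multilinear (E := fun=> E) sym_form.
Proof.
move=> x i a y z; rewrite !sym_formE -linearP; congr to_completion.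
apply/val_inj/funext => C; rewrite [LHS]sym_spanE.
transitivity (a *: lspan_val (sym_span (dfwith (T := fun=> E) x i y)) C +
  lspan_val (sym_span (dfwith (T := fun=> E) x i z)) C); last by [].
rewrite !sym_spanE scaler_sumr -big_split; apply: eq_bigr => f /injectiveP finj.
(* Changing the vector of index [i] changes exactly the slot [g i], the preimage of [i] under the
   permutation [f]. *)
have [g _ gK] := injF_bij finj.
rewrite -(gK i) !dfwith_comp_inj //.
by have := svalP C (x \o f) (g i) a y z.
Qed.

Lemma sym_form_diag x : sym_form (fun=> x) =
  #|[pred f : {ffun 'I_n -> 'I_n} | injectiveb f]|%:R *: stens n x.
Proof.
rewrite sym_formE -linearZ; congr to_completion.
apply/val_inj/funext => C; rewrite [LHS]sym_spanE.
transitivity (\sum_(f in [pred f : {ffun 'I_n -> 'I_n} | injectiveb f])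
  sval C (fun=> x)); first by [].
by rewrite sumr_const -scaler_nat.
Qed.

Lemma sym_form_multibounded : multibounded (E := fun=> E) sym_form.
Proof.
(* A sum of at most n vectors of the unit ball has norm at most n, and its tensor power norm at most
   n^n. *)
apply: (multibounded_ball sym_form_multilinear ltr01
  (M := \sum_(a : {ffun 'I_n -> bool}) modulus (subset_sign R c a) * n%:R ^+ n)).
move=> x hx; rewrite (le_trans (rnorm_sum _ _ _)) // ler_sum // => a _.
rewrite rnormZ ler_wpM2l ?modulus_ge0 // (le_trans (stens_rnorm_le _)) //.
rewrite lerXn2r ?nnegrE ?rnorm_ge0 // (le_trans (rnorm_sum _ _ _)) //.
rewrite -[n in leRHS]card_ord -sum1_card natr_sum ler_sum // => i _.
rewrite rnormZ; case: (a i); first by rewrite modulus1 mul1r ltW.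
by rewrite modulus0 mul0r.
Qed.

Lemma sym_form_lift (F : banach) (B : ('I_n -> E) -> F) (q : stensor n E -> F) x :
  multilinear (E := fun=> E) B -> bounded_op q ->
  (forall y, q (stens n y) = B (fun=> y)) ->
  q (sym_form x) = \sum_(f : {ffun 'I_n -> 'I_n} | injectiveb f) B (x \o f).
Proof.
move=> mB /bounded_opP[lq _] qB; rewrite -(polarization mB) //.
rewrite (linear_fun_sum lq); apply: eq_bigr => a _.
by rewrite (linear_funZ lq) qB.
Qed.

Lemma card_injective_neq0 :
  #|[pred f : {ffun 'I_n -> 'I_n} | injectiveb f]|%:R != 0 :> K.
Proof.
rewrite pnatr_eq0 -lt0n; apply/card_gt0P; exists [ffun i => i].
by apply/injectiveP => i j; rewrite !ffunE.
Qed.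

(** The diagonal inclusion followed by symmetrisation is multiplication by n!, the number of
    injective self-maps. *)
Lemma stensor_retract : retract (stensor n E) (ptensor_pow n E).
Proof.
have mptens := @ptens_multilinear R c n (fun=> E).
have bptens := @ptens_multibounded R c n (fun=> E).
have [s bs sE] := stensor_lift mptens bptens.
have [p bp pE] := ptensor_lift sym_form_multilinear sym_form_multibounded.
exists s, (fun y => #|[pred f : {ffun 'I_n -> 'I_n} | injectiveb f]|%:R^-1 *: p y).
  by split=> //; exact: bounded_op_scale.
have b1 := bounded_op_scale #|[pred f : {ffun 'I_n -> 'I_n} | injectiveb f]|%:R^-1
  (bounded_op_comp bs bp).
apply: (stensor_op_eq b1 (bounded_op_id _)) => x.
by rewrite /= sE pE sym_form_diag scalerK // card_injective_neq0.
Qed.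

End Symmetrization.
End Retracts.

(** * Contraction with a functional *)

Section Contraction.
Variables (R : realType) (c : scalar_kind).
Local Notation K := (scalars R c).
Local Notation banach := (completeNormedModType K).
Variables (E : banach) (phi : E -> K) (e : E).
Hypothesis lphi : forall a x y, phi (a *: x + y) = a * phi x + phi y.
Hypothesis bphi : exists2 M, 0 <= M & forall x, modulus (phi x) <= M * rnorm x.
Hypothesis phie : phi e = 1.

Let phiZ a x : phi (a *: x) = a * phi x.
Proof. exact: (@linear_funZ R c E K^o phi). Qed.

Let phiD x y : phi (x + y) = phi x + phi y.
Proof. exact: (@linear_funD R c E K^o phi). Qed.

Section Forms.
Variables (k n : nat) (iota : 'I_k -> 'I_n).
Hypothesis iota_inj : injective iota.

Section Contract.
Variables (F : banach) (C : ('I_k -> E) -> F).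
Hypotheses (mC : multilinear (E := fun=> E) C) (bC : multibounded (E := fun=> E) C).

(** [iota] and [C] are left general for two uses: the tensor map of the k-th power gives the
    projection between full powers, and a single retained slot gives the contraction of the
    symmetric power to [E]. *)
Definition contract (y : 'I_n -> E) : F :=
  (\prod_(j < n | j \notin codom iota) phi (y j)) *: C (y \o iota).

Lemma contract_multilinear : multilinear (E := fun=> E) contract.
Proof.
move=> x i a y z; rewrite /contract.
have [ic|ic] := boolP (i \in codom iota).
  have prodE u : \prod_(j < n | j \notin codom iota) phi (dfwith (T := fun=> E) x i u j) =
      \prod_(j < n | j \notin codom iota) phi (x j).
    apply: eq_bigr => j jc; rewrite dfwith_funE; case: eqVneq => // ij.
    by rewrite -ij ic in jc.
  rewrite !prodE; move/codomP: ic => [l ->]; rewrite !dfwith_comp_inj //.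
  have -> := @mC (x \o iota) l a y z.
  by rewrite scalerDr !scalerA mulrC.
rewrite !dfwith_comp_notin // scalerA -scalerDl; congr (_ *: _).
have prodE u : \prod_(j < n | j \notin codom iota) phi (dfwith (T := fun=> E) x i u j) =
    phi u * \prod_(j < n | (j \notin codom iota) && (j != i)) phi (x j).
  rewrite (bigD1 i) //= dfwithin; congr (_ * _).
  by apply: eq_bigr => j /andP[_ ji]; rewrite dfwithout // eq_sym.
by rewrite !prodE lphi mulrDl mulrA.
Qed.

Lemma contract_multibounded : multibounded (E := fun=> E) contract.
Proof.
have [M M0 hM] := multibounded_rnorm_le1 bC; have [N N0 hN] := bphi.
apply: (multibounded_ball contract_multilinear ltr01
  (M := \prod_(j < n | j \notin codom iota) N * M)) => x hx.
have modulus_prod (P : pred 'I_n) (f : 'I_n -> K) :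
    modulus (\prod_(j | P j) f j) = \prod_(j | P j) modulus (f j).
  exact: (big_morph modulus (@modulusM R c) (modulus1 R c)).
rewrite rnormZ modulus_prod ler_pM ?rnorm_ge0 //.
- by apply: prodr_ge0 => j _; exact: modulus_ge0.
- apply: ler_prod => j _; rewrite modulus_ge0 (le_trans (hN _)) //.
  by rewrite ler_piMr // ltW.
by apply: hM => i; exact/ltW/hx.
Qed.

End Contract.

Definition fill (x : 'I_k -> E) (i : 'I_n) : E :=
  if [pick j | iota j == i] is Some j then x j else e.

Lemma fill_iota x : fill x \o iota = x.
Proof.
apply/funext => j; rewrite /= /fill; case: pickP => [l /eqP/iota_inj -> //|/(_ j)].
by rewrite eqxx.
Qed.

Lemma fill_notin x i : i \notin codom iota -> fill x i = e.
Proof.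
move=> ic; rewrite /fill; case: pickP => // j /eqP ji.
by rewrite -ji codom_f in ic.
Qed.

Lemma fill_dfwith x j z :
  fill (dfwith (T := fun=> E) x j z) = dfwith (T := fun=> E) (fill x) (iota j) z.
Proof.
apply/funext => i; rewrite dfwith_funE /fill; case: pickP => [l /eqP <-|h].
  by rewrite dfwith_funE (inj_eq iota_inj).
by case: eqVneq => // ji; have := h j; rewrite ji eqxx.
Qed.

Lemma contract_fill (F : banach) (C : ('I_k -> E) -> F) x :
  contract C (fill x) = C x.
Proof.
rewrite /contract fill_iota big1 ?scale1r // => i ic.
by rewrite fill_notin.
Qed.

Lemma ptensor_pow_retract_inj : retract (ptensor_pow k E) (ptensor_pow n E).
Proof.
have mk := @ptens_multilinear R c k (fun=> E).
have bk := @ptens_multibounded R c k (fun=> E).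
have [p bp pE] := ptensor_lift (contract_multilinear mk) (contract_multibounded mk bk).
pose B (x : 'I_k -> E) : ptensor_pow n E := ptens (fill x).
have mB : multilinear (E := fun=> E) B.
  move=> x j a y z; rewrite /B !fill_dfwith.
  exact: (@ptens_multilinear R c n (fun=> E) (fill x) (iota j)).
have bB : multibounded (E := fun=> E) B.
  have [M M0 hM] := @ptens_multibounded R c n (fun=> E).
  (* Each slot of [fill x] holds either a vector of the unit ball or [e]. *)
  apply: (multibounded_ball mB ltr01
    (M := M * \prod_(i < n) Num.max 1 (rnorm e))) => x hx.
  rewrite (le_trans (hM _)) // ler_wpM2l // ler_prod // => i _.
  rewrite rnorm_ge0 /fill /= le_max; case: pickP => [j _|_].
    by rewrite ltW.
  by rewrite lexx orbT.
have [s bs sE] := ptensor_lift mB bB.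
exists s, p => //; apply: (ptensor_op_eq (bounded_op_comp bs bp) (bounded_op_id _)) => x.
by rewrite /= sE pE contract_fill.
Qed.

End Forms.

(** Symmetrising with [x] in the slot [i0] and contracting every other slot yields a sum over
    permutations. Those fixing [i0], al = (n-1)! in number, return [x]; the other be = n! - (n-1)!
    return phi(x) e. *)
Lemma stensor_retract_base n : (0 < n)%N -> retract E (stensor n E).
Proof.
move=> n_gt0; pose i0 : 'I_n := Ordinal n_gt0.
pose iota (_ : 'I_1) : 'I_n := i0.
have iota_inj : injective iota by move=> i j _; rewrite !ord1.
pose C (y : 'I_1 -> E) : E := y ord0.
have mC : multilinear (E := fun=> E) C.
  by move=> x i a y z; rewrite /C (ord1 i) !dfwithin.
have bC : multibounded (E := fun=> E) C.
  by exists 1 => // x; rewrite big_ord1 mul1r.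
have mQ := contract_multilinear iota_inj mC.
have [q bq qE] := stensor_lift mQ (contract_multibounded iota_inj mC bC).
have codom_iota j : (j \in codom iota) = (j == i0).
  by apply/codomP/eqP => [[l ->] //|->]; exists ord0.
pose X (x : E) := dfwith (T := fun=> E) (fun=> e) i0 x.
pose P := [pred f : {ffun 'I_n -> 'I_n} | injectiveb f & f i0 == i0].
pose P' := [pred f : {ffun 'I_n -> 'I_n} | injectiveb f & f i0 != i0].
pose al : K := #|P|%:R; pose be : K := #|P'|%:R.
have al0 : al != 0.
  rewrite pnatr_eq0 -lt0n; apply/card_gt0P; exists [ffun i => i].
  rewrite !inE ffunE eqxx andbT.
  by apply/injectiveP => i j; rewrite !ffunE.
have ab0 : al + be != 0.
  by rewrite -natrD pnatr_eq0 addn_eq0 negb_and -(pnatr_eq0 K) al0.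
have termE (f : {ffun 'I_n -> 'I_n}) x : injectiveb f ->
    contract iota C (X x \o f) = if f i0 == i0 then x else phi x *: e.
  move=> /injectiveP finj; rewrite /contract /C /= /iota /X dfwith_funE eq_sym.
  rewrite (eq_bigl (fun j => j != i0)); last by move=> j; rewrite codom_iota.
  case: eqVneq => fi0.
    rewrite big1 ?scale1r // => j ji0; rewrite dfwithout //.
    by rewrite -fi0 eq_sym (inj_eq finj).
  (* The retained slot now holds [e], and [x] sits in the slot [g i0], where [phi] is applied to
     it. *)
  have [g fK gK] := injF_bij finj.
  congr (_ *: _); rewrite (bigD1 (g i0)) /=; last first.
    by apply: contraNneq fi0 => gi0; rewrite -{1}gi0 gK.
  rewrite gK dfwithin big1 ?mulr1 // => j /andP[_ jg]; rewrite dfwithout //.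
  by apply: contraNneq jg => ->; rewrite fK.
have qi x : q (sym_form (X x)) = al *: x + (be * phi x) *: e.
  rewrite (sym_form_lift n_gt0 _ mQ bq qE) (bigID (fun f : {ffun _ -> _} => f i0 == i0)) /=.
  congr (_ + _).
    transitivity (\sum_(f in P) x); last by rewrite sumr_const -scaler_nat.
    by apply: eq_bigr => f /andP[fi fi0]; rewrite termE // fi0.
  transitivity (\sum_(f in P') phi x *: e).
    by apply: eq_bigr => f /andP[fi /negPf fi0]; rewrite termE // fi0.
  by rewrite sumr_const -scaler_nat scalerA.
(* For y = al x + be phi(x) e, phi e = 1 gives phi y = (al + be) phi x; this recovers be phi(x) e
   from y. *)
pose r (y : E) := al^-1 *: (- (be / (al + be)) *: (phi y *: e) + y).
have [N N0 hN] := bphi.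
have br : bounded_op r.
  apply: bounded_op_scale; apply: bounded_op_lincomb; last exact: bounded_op_id.
  apply/bounded_opP; split=> [a x y|]; first by rewrite lphi scalerDl scalerA.
  exists (N * rnorm e) => [|x]; first by rewrite mulr_ge0 ?rnorm_ge0.
  by rewrite rnormZ mulrAC ler_wpM2r ?rnorm_ge0.
have bi : bounded_op (fun x => sym_form (X x)).
  apply/bounded_opP; split.
    by move=> a x y; have := @sym_form_multilinear R c n E n_gt0 (fun=> e) i0 a x y.
  have [M M0 hM] := @sym_form_multibounded R c n E n_gt0.
  exists (M * \prod_(i < n | i != i0) rnorm e) => [|x].
    by rewrite mulr_ge0 // prodr_ge0 // => i _; exact: rnorm_ge0.
  rewrite (le_trans (hM _)) // (bigD1 i0) //= /X dfwithin -mulrA ler_wpM2l // mulrC.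
  rewrite ler_wpM2r ?rnorm_ge0 // le_eqVlt; apply/orP; left; apply/eqP.
  by apply: eq_bigr => i ii0; rewrite dfwithout // eq_sym.
exists (fun x => sym_form (X x)), (r \o q); first by split=> //; exact: bounded_op_comp.
move=> x; rewrite /= qi /r phiD !phiZ phie mulr1 -mulrDl scalerA.
rewrite mulNr mulrA divfK // addrCA -scalerDl addNr scale0r addr0.
by rewrite scalerA mulVf // scale1r.
Qed.

End Contraction.

(** * Uniform approximation on families of sets *)

Section UniformClosure.
Variables (R : realType) (c : scalar_kind).
Local Notation K := (scalars R c).
Local Notation banach := (completeNormedModType K).

(** By directedness, finitely many members of [fam] can be replaced by a single one, so the sets of
    functions close to [f] on one member generate a filter. It converges to [f], hence contains
    every neighbourhood of [f]. *)
Lemma closure_familyP (E F : banach) (fam : set (set E)) (I : set (E -> F)) (f : E -> F) :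
  (exists S, fam S) ->
  (forall S1 S2, fam S1 -> fam S2 -> exists2 S, fam S & S1 `|` S2 `<=` S) ->
  closure (I : set {family fam, E -> F}) f <->
  (forall S (e : R), fam S -> 0 < e ->
    exists2 v, I v & forall x, S x -> rnorm (f x - v x) < e).
Proof.
move=> [S0 famS0] dir; split=> [cf S e famS e0|h].
  have eK : 0 < ofR e :> K by rewrite -(ofR0 R c) ltr_ofR.
  have entE : entourage [set xy : F * F | ball xy.1 (ofR e) xy.2].
    by rewrite -entourage_ballE; exists (ofR e).
  have [v [Iv hv]] := cf _ (fam_nbhs (f : {family fam, E -> F}) entE famS).
  exists v => // x Sx; have := hv x Sx; rewrite /= -ball_normE /= rnormE.
  by rewrite ltr_ofR.
move=> N fN.
pose G : set_system (E -> F) := [set B | exists S (e : R),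
  [/\ fam S, 0 < e & forall g, (forall x, S x -> rnorm (f x - g x) < e) -> B g]].
have GF : Filter G.
  split; first by exists S0, 1.
    move=> B B' [S [e [famS e0 hB]]] [S' [e' [famS' e'0 hB']]].
    have [T famT ST] := dir _ _ famS famS'.
    exists T, (Num.min e e'); split=> //; first by rewrite lt_min e0.
    by move=> g hg; split; [apply: hB|apply: hB'] => x Sx;
      have := hg x (ST _ _); rewrite lt_min => /(_ _)/andP[]//;
      [left|right].
  move=> B B' BB' [S [e [famS e0 hB]]]; exists S, e; split=> // g hg.
  exact/BB'/hB.
have : {family fam, G --> f}.
  apply/fam_cvgP => S famS B /uniform_nbhs[D [entD DB]].
  move: entD; rewrite -entourage_ballE => -[_ /= /gt0_ofR[e e0 <-] eD].
  exists S, e; split=> // g hg; apply: DB => x Sx; apply: eD.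
  by rewrite /= -ball_normE /= rnormE ltr_ofR; exact: hg.
move=> /(_ N fN)[S [e [famS e0 hN]]].
have [v Iv hv] := h S e famS e0.
by exists v; split=> //; exact: hN.
Qed.

Lemma bounded_set_rnorm (E : banach) (S : set E) : bounded_set S ->
  exists2 r : R, 0 <= r & forall x, S x -> rnorm x <= r.
Proof.
move=> bS; have [_ /gt0_ofR[r r0 <-] hr] := ex_strict_bound_gt0 bS.
exists r; first exact: ltW.
by move=> x Sx; have := hr x Sx; rewrite /= rnormE ltr_ofR => /ltW.
Qed.

(** The vectors satisfying the bound form a convex set, which therefore contains the hull;
    continuity of [D] carries the bound to the closure. *)
Lemma closed_conv_rnorm_le (E F : banach) (D : E -> F) (S : set E) (d : R) :
  bounded_op D -> (forall x, S x -> rnorm (D x) <= d) ->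
  forall x, closed_conv S x -> rnorm (D x) <= d.
Proof.
move=> /bounded_opP[lD [M M0 hM]] hS x cx.
have hull y : smallest (@convex_set K E) S y -> rnorm (D y) <= d.
  apply: (@smallest_sub _ (@convex_set K E) S [set y | rnorm (D y) <= d]); last first.
    exact: hS.
  move=> {}y z l; rewrite !inE /= => hy hz.
  rewrite [X in D X](_ : _ = l%:num *: (y : E) + (1 - l%:num) *: (z : E)) //.
  have l0 : 0 <= l%:num :> K by [].
  have l1 : 0 <= 1 - l%:num :> K by rewrite subr_ge0.
  rewrite lD (linear_funZ lD) (le_trans (rnormD _ _)) // !rnormZ.
  (* The weight satisfies 0 <= l <= 1 in the order of [K], so it is real even for complex [K], and
     the two moduli add up to 1. *)
  have -> : d = modulus (l%:num : K) * d + modulus (1 - l%:num : K) * d.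
    rewrite -mulrDl -[LHS]mul1r; congr (_ * _); apply: (@ofR_inj R c).
    by rewrite ofRD !ofR_modulus !ger0_norm // addrC subrK ofR1.
  by rewrite lerD // ler_wpM2l // modulus_ge0.
apply/ler_addgt0Pr => e e0; have M1 : 0 < M + 1 by rewrite ltr_wpDl.
have eK : 0 < ofR (e / (M + 1)) :> K by rewrite -(ofR0 R c) ltr_ofR divr_gt0.
have [y [hy]] := cx _ (nbhsx_ballx x _ eK).
rewrite -ball_normE /= rnormE ltr_ofR => xy.
rewrite -(subrK (D y) (D x)) addrC (le_trans (rnormD _ _)) // lerD ?hull //.
rewrite -(linear_funB lD) (le_trans (hM _)) //.
rewrite ltr_pdivlMr // in xy; rewrite (le_trans _ (ltW xy)) // mulrC.
by rewrite ler_wpM2l ?rnorm_ge0 // lerDl.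
Qed.

End UniformClosure.

(** * Permanence of the weak approximation property *)

Section WeakApproximation.
Variables (R : realType) (c : scalar_kind).
Local Notation K := (scalars R c).
Local Notation banach := (completeNormedModType K).
Variables (C : banach -> Prop) (A : set_assignment R c).
Hypotheses (admA : admissible C A) (dirA : union_directed A).

Lemma tau_closureP (I : operator_class R c) (E F : banach) (u : E -> F) :
  tau_closure A I E F u <->
  bounded_op u /\ forall S (e : R), @A E S -> 0 < e ->
    exists2 v, @I E F v & forall x, S x -> rnorm (u x - v x) < e.
Proof.
have cP := closure_familyP (@I E F) u (ex_intro _ _ (adm_singleton _ _ admA E 0)) (@dirA E).
by split=> -[bu hu]; split=> //; apply/cP.
Qed.

Variables (I J : operator_class R c).
Hypotheses (idI : operator_ideal I) (idJ : operator_ideal J).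

(** The image of a member of the assignment under [i] is again a member, so [u] can be approximated
    there, with an error that absorbs the bound of [p]. *)
Lemma tau_closure_comp (X0 X Y Y0 : banach) (i : X0 -> X) (u : X -> Y) (p : Y -> Y0) :
  bounded_op i -> tau_closure A I X Y u -> bounded_op p ->
  tau_closure A I X0 Y0 (p \o u \o i).
Proof.
move=> bi /tau_closureP[bu hu] bp; apply/tau_closureP; split.
  by apply: bounded_op_comp => //; exact: bounded_op_comp.
move=> S e AS e0; have /bounded_opP[lp [M M0 hM]] := bp.
have M1 : 0 < M + 1 by rewrite ltr_wpDl.
have [v Iv hv] := hu _ _ (adm_image _ _ admA _ _ _ _ AS bi) (divr_gt0 e0 M1).
exists (p \o v \o i); first exact: (ideal_comp _ idI).
move=> x Sx /=; rewrite -(linear_funB lp) (le_lt_trans (hM _)) //.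
have := hv (i x) (ex_intro2 _ _ _ Sx erefl); rewrite ltr_pdivlMr // => h.
rewrite (le_lt_trans _ h) // mulrC.
by rewrite ler_wpM2l ?rnorm_ge0 // lerDl.
Qed.

(** The operator [u] equals p (i u p) i, whose middle factor lies in [J] on [Y]. *)
Lemma WAP_retract (X Y : banach) : retract X Y -> WAP J I A Y -> WAP J I A X.
Proof.
move=> [i [p [bi bp] ip]] wY u Ju.
have -> : u = p \o (i \o u \o p) \o i by apply/funext => x; rewrite /= !ip.
apply: tau_closure_comp => //; apply: wY.
exact: (ideal_comp _ idJ).
Qed.

(** Covers the case in which no functional [phi] exists: a bounded operator on the zero space has
    rank 0, hence lies in [I]. *)
Lemma WAP_trivial (X : banach) : (forall x : X, x = 0) -> WAP J I A X.
Proof.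
move=> X0 u Ju; apply/tau_closureP; have bu := ideal_sub _ idJ _ _ _ Ju.
split=> // S e _ e0; exists u => [|x _]; last by rewrite subrr rnorm0.
apply: (ideal_finite_rank _ idI) => //; exists 0%N, (fun=> 0) => x.
by exists (fun=> 0); rewrite big_ord0; exact: X0.
Qed.

Lemma union_directed_finite (E : banach) m (T : 'I_m -> set E) :
  (forall l, @A E (T l)) -> exists2 S, @A E S & forall l, T l `<=` S.
Proof.
move=> AT; suff key (s : seq 'I_m) :
    exists2 S, @A E S & forall l, l \in s -> T l `<=` S.
  have [S AS hS] := key (enum 'I_m); exists S => // l.
  by apply: hS; rewrite mem_enum.
elim: s => [|l s [S AS hS]]; first by exists [set 0] => //; exact: (adm_singleton _ _ admA).
have [S' AS' hS'] := dirA (AT l) AS; exists S' => // k.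
rewrite inE => /orP[/eqP ->|ks] x Tx; apply: hS'; first by left.
by right; exact: hS ks _ Tx.
Qed.

(* On the members of A(E)^n the form T o (x) = B(T_1, ..., T_n) is approximated
   by B(U_1, ..., U_n) with U_j in I, which factors through an operator of the
   closure of I; both sides linearise, and the estimate passes from tensors to
   closed convex hulls. *)
Lemma WAP_ptensor_pow n (E : banach) : (0 < n)%N -> C E ->
  (forall F : banach, @comp_right R c I n (fun=> E) F `<=`
    comp_left (tau_closure A I) (fun=> E) F) ->
  comp_left J (fun _ : 'I_n => E) (ptensor_pow n E) `<=`
    comp_right_endo J n E (ptensor_pow n E) ->
  WAP J I A E -> WAP J I A (ptensor_pow n E).
Proof.
move=> n_gt0 CE hI hJ wE T JT.
have bT : bounded_op T := ideal_sub _ idJ _ _ _ JT.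
have [U [B [JU /cont_multilinearP[mB bB] TE]]] :
    comp_right_endo J n E (ptensor_pow n E) (T \o @ptens R c n (fun=> E)).
  apply: hJ; exists (ptensor_pow n E), (@ptens R c n (fun=> E)), T; split=> //.
  exact: ptens_cont_multilinear.
apply/tau_closureP; split=> // S e AS e0.
have [hS _ _ _] := adm_tensor _ _ admA n (fun=> E) E n_gt0 CE
  (ex_intro _ (Ordinal n_gt0) CE).
have [m [Q [AQ SQ]]] := hS S AS.
(* [V j] contains the j-th factors of all the pieces covering [S], so that one operator per
   coordinate serves every piece. *)
have /choice[V hV] j : exists V, @A E V /\ forall l, Q l j `<=` V.
  have [|V AV QV] := @union_directed_finite E m (fun l => Q l j); first by move=> l.
  by exists V.
have /choice[r hr] j : exists r : R, 0 <= r /\ forall x, V j x -> rnorm (U j x) <= r.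
  have [r r0 hr] := bounded_set_rnorm (adm_bounded _ _ admA _ _ (hV j).1).
  have /bounded_opP[_ [M M0 hM]] := ideal_sub _ idJ _ _ _ (JU j).
  exists (M * r); split=> [|x Vx]; first exact: mulr_ge0.
  by rewrite (le_trans (hM x)) // ler_wpM2l // hr.
pose r1 := \sum_j r j + 1.
have rr1 j : r j + 1 <= r1.
  rewrite lerD2r (bigD1 j) //= lerDl sumr_ge0 // => k _.
  by case: (hr k).
have r10 : 0 <= r1 by rewrite addr_ge0 // sumr_ge0 // => j _; case: (hr j).
have [L L0 hL] := multilinear_lipschitz mB bB r10.
(* The bound 1 keeps the perturbed coordinates in the ball of radius [r1]; the other bound makes the
   multilinear error at most e / 2. The remaining half is spent on approximating [w \o Y] by an
   element of [I]. *)
pose d := Num.min 1 (e / 2 / (L + 1)).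
have L1 : 0 < L + 1 by rewrite ltr_wpDl.
have d0 : 0 < d by rewrite lt_min ltr01 !divr_gt0.
have /choice[W hW] j : exists W, @I E E W /\ forall x, V j x -> rnorm (U j x - W x) < d.
  have /tau_closureP[_ h] := wE _ (JU j).
  by have [W IW hW] := h _ _ (hV j).1 d0; exists W.
have [G [B' [w [/cont_multilinearP[mB' bB'] cw BE]]]] :
    comp_left (tau_closure A I) (fun=> E) (ptensor_pow n E) (fun x => B (fun j => W j (x j))).
  apply: hI; exists (fun=> E), W, B; split=> //; last exact/cont_multilinearP.
  by move=> j; case: (hW j).
have [Y bY YE] := ptensor_lift mB' bB'.
have /tau_closureP[bwY hwY] : tau_closure A I (ptensor_pow n E) (ptensor_pow n E) (w \o Y).
  exact: (tau_closure_comp bY cw (bounded_op_id _)).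
have e2 : 0 < e / 2 by rewrite divr_gt0.
have [v Iv hv] := hwY S _ AS e2.
exists v => // z Sz.
rewrite (le_lt_trans (rnorm_distD (w (Y z)) _ _)) // [e]splitr ler_ltD //; last exact: hv.
have [l _ Qz] := SQ z Sz.
(* The hull estimate is made for the difference of [T] and [w \o Y], not of [T] and [v]: closeness
   of [v] to [w \o Y] is known on [S] only, and the elementary tensors generating the hull need not
   lie in [S]. *)
have bD : bounded_op (fun z => -1 *: w (Y z) + T z) by exact: bounded_op_lincomb.
suff : rnorm (-1 *: w (Y z) + T z) <= e / 2 by rewrite scaleN1r addrC.
apply: (closed_conv_rnorm_le bD _ Qz) => _ [x Qx <-].
have Vx j : V j (x j) by apply: (hV j).2; exact: Qx.
have := congr1 (fun f => f x) TE; rewrite /= => ->.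
have := congr1 (fun f => f x) BE; rewrite /= YE => <-.
rewrite scaleN1r addrC.
rewrite (le_trans (hL (fun j => U j (x j)) (fun j => W j (x j)) d (ltW d0) _ _ _)) //.
- by move=> j; rewrite (le_trans ((hr j).2 _ (Vx j))) // (le_trans _ (rr1 j)) // lerDl.
- move=> j; rewrite (le_trans _ (rr1 j)) // -(subrK (U j (x j)) (W j (x j))).
  rewrite (le_trans (rnormD _ _)) // addrC lerD //; first exact: (hr j).2.
  rewrite rnorm_distC (le_trans (ltW ((hW j).2 _ (Vx j)))) //.
  by rewrite ge_min lexx.
- by move=> j; exact/ltW/((hW j).2 _ (Vx j)).
have dle : d <= e / 2 / (L + 1) by rewrite ge_min lexx orbT.
rewrite (le_trans (ler_wpM2l L0 dle)) // mulrA ler_pdivrMr // mulrC.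
by rewrite ler_wpM2l ?(ltW e2) // lerDl.
Qed.

End WeakApproximation.

(** * Transfer between [E] and its tensor powers *)

Section TensorPowers.
Variables (R : realType) (c : scalar_kind).
Local Notation K := (scalars R c).
Local Notation banach := (completeNormedModType K).
Variable E : banach.

Lemma ptensor_pow_trivial n : (0 < n)%N -> (forall x : E, x = 0) ->
  forall z : ptensor_pow n E, z = 0.
Proof.
move=> n_gt0 E0 z; have zeroP : bounded_op (fun _ : ptensor_pow n E => 0 : ptensor_pow n E).
  apply/bounded_opP; split=> [a x y|]; first by rewrite scaler0 addr0.
  by exists 0 => // x; rewrite rnorm0 mul0r.
apply: (ptensor_op_eq (bounded_op_id _) zeroP) => x.
exact: (multilinear0 (@ptens_multilinear R c n (fun=> E)) (E0 (x (Ordinal n_gt0)))).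
Qed.

Lemma trivial_or_functional : (forall x : E, x = 0) \/
  exists (phi : E -> K) (e : E),
  [/\ forall a x y, phi (a *: x + y) = a * phi x + phi y,
      exists2 M, 0 <= M & forall x, modulus (phi x) <= M * rnorm x
    & phi e = 1].
Proof.
have [[e e0]|E0] := pselect (exists e : E, e != 0).
  by right; have [phi h] := exists_bounded_functional e0; exists phi, e.
left=> x; apply/eqP/negPn/negP => x0; apply: E0.
by exists x.
Qed.

Variables (C : banach -> Prop) (A : set_assignment R c).
Hypotheses (admA : admissible C A) (dirA : union_directed A).
Variables (I J : operator_class R c).
Hypotheses (idI : operator_ideal I) (idJ : operator_ideal J).

Lemma WAP_ptensor_pow_le k n : (0 < k <= n)%N ->
  WAP J I A (ptensor_pow n E) -> WAP J I A (ptensor_pow k E).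
Proof.
move=> /andP[k_gt0 kn]; have [E0 _|[phi [e [lphi bphi phie]]]] := trivial_or_functional.
  by apply: (WAP_trivial admA dirA idI idJ); exact: ptensor_pow_trivial.
apply: (WAP_retract admA dirA idI idJ).
apply: (ptensor_pow_retract_inj lphi bphi phie (iota := widen_ord kn)).
by move=> i j /(congr1 val) /= ij; exact: val_inj.
Qed.

Lemma WAP_stensor n : (0 < n)%N ->
  WAP J I A (ptensor_pow n E) -> WAP J I A (stensor n E).
Proof.
by move=> n_gt0; apply: (WAP_retract admA dirA idI idJ); exact: stensor_retract.
Qed.

Lemma WAP_of_stensor n : (0 < n)%N -> WAP J I A (stensor n E) -> WAP J I A E.
Proof.
move=> n_gt0; have [E0 _|[phi [e [lphi bphi phie]]]] := trivial_or_functional.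
  exact: (WAP_trivial admA dirA idI idJ).
apply: (WAP_retract admA dirA idI idJ).
exact: (stensor_retract_base lphi bphi phie).
Qed.

End TensorPowers.

Unset Implicit Arguments.

Theorem corollary4p21 (R : realType) (c : scalar_kind)
    (C : completeNormedModType (scalars R c) -> Prop)
    (A : set_assignment R c) (I J : operator_class R c)
    (E : completeNormedModType (scalars R c)) :
  admissible C A -> union_directed A ->
  operator_ideal I -> operator_ideal J ->
  (forall n (Es : 'I_n -> completeNormedModType (scalars R c))
      (F : completeNormedModType (scalars R c)), (0 < n)%N ->
    comp_right I Es F `<=` comp_left (tau_closure A I) Es F) ->
  C E ->
  ((forall n, (0 < n)%N ->
      comp_left J (fun _ : 'I_n => E) (ptensor_pow n E) `<=`
      comp_right_endo J n E (ptensor_pow n E)) ->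
    [<-> WAP J I A E;
         forall n, (0 < n)%N -> WAP J I A (ptensor_pow n E);
         exists2 n, (0 < n)%N & WAP J I A (ptensor_pow n E);
         forall n, (0 < n)%N -> WAP J I A (stensor n E);
         exists2 n, (0 < n)%N & WAP J I A (stensor n E)]) /\
  (forall n, (0 < n)%N ->
    comp_left J (fun _ : 'I_n => E) (ptensor_pow n E) `<=`
    comp_right_endo J n E (ptensor_pow n E) ->
    [<-> WAP J I A E;
         forall k, (0 < k <= n)%N -> WAP J I A (ptensor_pow k E);
         exists2 k, (0 < k <= n)%N & WAP J I A (ptensor_pow k E);
         forall k, (0 < k <= n)%N -> WAP J I A (stensor k E);
         exists2 k, (0 < k <= n)%N & WAP J I A (stensor k E)]).
Proof.
move=> admA dirA idI idJ hI CE.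
have up n : (0 < n)%N ->
    comp_left J (fun _ : 'I_n => E) (ptensor_pow n E) `<=`
    comp_right_endo J n E (ptensor_pow n E) ->
    WAP J I A E -> WAP J I A (ptensor_pow n E).
  move=> n_gt0 hJ; apply: (WAP_ptensor_pow admA dirA idI idJ n_gt0 CE) => // F.
  exact: hI.
have sym n : (0 < n)%N -> WAP J I A (ptensor_pow n E) -> WAP J I A (stensor n E).
  exact: (WAP_stensor admA dirA idI idJ).
have down n : (0 < n)%N -> WAP J I A (stensor n E) -> WAP J I A E.
  exact: (WAP_of_stensor admA dirA idI idJ).
split=> [hJ|n n_gt0 hJ]; tfae.
- by move=> wE n n_gt0; apply: up => //; exact: hJ.
- by move=> h; exists 1%N => //; exact: h.
(* The exponents [m] and [n] are unrelated, so the passage goes down to [E] through the symmetric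
   m-th power and up again. *)
- move=> [m m_gt0 wm] n n_gt0; apply: (sym n) => //; apply: (up n) => //; first exact: hJ.
  by apply: (down m) => //; exact: sym.
- by move=> h; exists 1%N => //; exact: h.
- by move=> [n n_gt0 wn]; exact: down wn.
(* The factorisation hypothesis is available at the exponent [n] only, so the k-th power is reached
   through the n-th. *)
- move=> wE k kn; apply: (WAP_ptensor_pow_le admA dirA idI idJ kn).
  exact: up.
- by move=> h; exists 1%N; rewrite ?n_gt0 //; apply: h; rewrite n_gt0.
- move=> [m /andP[m_gt0 mn] wm] k kn; apply: (sym k); first by case/andP: kn.
  apply: (WAP_ptensor_pow_le admA dirA idI idJ kn); apply: up => //.
  by apply: (down m) => //; exact: sym.
- by move=> h; exists 1%N; rewrite ?n_gt0 //; apply: h; rewrite n_gt0.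
- by move=> [k /andP[k_gt0 kn] wk]; exact: down wk.
Qed.
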